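(* Let $r\ge1$ be an integer and $\delta\in[0,1/2]$. Then $$R^{(\mathrm{lin})}(r,\delta)\le\min_{0\le s<1/(r+1)}\Big\{sr+(1-s(r+1))\,R_0\Big(r,\frac{\delta}{1-s(r+1)}\Big)\Big\},$$ where $R_0(r,\delta):=h(\tau)-c(r+1,\tau)$, $c(w,\tau):=\frac{\log_2 e}{8w^2}\Big(\frac{\tau^w}{2}\Big)^{w+1}$, and $\tau:=\frac12-\sqrt{\delta(1-\delta)}$ (with $\delta$ in the definition of $\tau$ being the second argument of $R_0$).
   Context: A binary code $\mathcal{C}\subseteq\{0,1\}^n$ has locality $r$ if every coordinate $i\in[n]$ is contained in a subset $\mathcal{R}_i\subseteq[n]$ of size $r+1$ such that for some function $\phi_i:\{0,1\}^r\to\{0,1\}$, $c_i=\phi_i(c_{j_1},\dots,c_{j_r})$ for every codeword $c$, where $j_1<\dots<j_r$ are the elements of $\mathcal{R}_i\setminus\{i\}$. Let $M^{(\mathrm{lin})}(n,r,d)$ be the maximum cardinality of a binary linear code of length $n$, minimum Hamming distance $d$ and locality $r$, and $R^{(\mathrm{lin})}(r,\delta)=\limsup_{n\to\infty}\frac1n\log_2M^{(\mathrm{lin})}(n,r,\delta n)$. $h(x)=-x\log_2x-(1-x)\log_2(1-x)$ is the binary entropy function. *)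

(* Defs.v *)
From mathcomp Require Import all_boot all_order all_algebra.
From mathcomp Require Import all_classical all_reals all_analysis.
Set Implicit Arguments. Unset Strict Implicit. Unset Printing Implicit Defensive.
Import Order.TTheory GRing.Theory Num.Theory.
Local Open Scope ring_scope.

Definition is_linear_code (n : nat) (C : {set 'rV['F_2]_n}) : Prop :=
  0 \in C /\ forall x y, x \in C -> y \in C -> x + y \in C.

Definition hamming (n : nat) (x y : 'rV['F_2]_n) : nat := #|[set i | x 0 i != y 0 i]|.

Definition min_dist_ge (R : realType) (n : nat) (C : {set 'rV['F_2]_n}) (d : R) : Prop :=
  forall x y, x \in C -> y \in C -> x != y -> d <= (hamming x y)%:R.

(* Locality r: every coordinate i lies in a set R_i of size r+1 such that
   c_i = phi_i (c_{j_1}, ..., c_{j_r}) for all codewords c, where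
   j_1 < ... < j_r enumerate R_i \ {i} (enum of a set of ordinals is increasing). *)
Definition has_locality (n r : nat) (C : {set 'rV['F_2]_n}) : Prop :=
  forall i : 'I_n, exists Ri : {set 'I_n},
    [/\ i \in Ri, #|Ri| = r.+1 &
      exists phi : seq 'F_2 -> 'F_2,
        forall c, c \in C -> c 0 i = phi [seq c 0 j | j <- enum (Ri :\ i)]].

(* M^(lin)(n, r, d): maximum cardinality (0 if no such code exists). *)
Definition M_lin (R : realType) (n r : nat) (d : R) : nat :=
  \max_(C : {set 'rV['F_2]_n} | `[< is_linear_code C /\ has_locality r C /\ min_dist_ge C d >]) #|C|.

Definition log2 (R : realType) (x : R) : R := ln x / ln 2.

Definition R_lin (R : realType) (r : nat) (delta : R) : \bar R :=
  limn_esup (fun n : nat => ((n%:R)^-1 * log2 (M_lin n r (delta * n%:R))%:R)%:E).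

(* Binary entropy (ln 0 = 0 convention gives h 0 = h 1 = 0). *)
Definition h2 (R : realType) (x : R) : R := - x * log2 x - (1 - x) * log2 (1 - x).

Definition c_const (R : realType) (w : nat) (tau : R) : R :=
  (log2 (expR 1)) / (8 * (w ^+ 2)%:R) * (tau ^+ w / 2) ^+ w.+1.

Definition tau_of (R : realType) (delta : R) : R := 1 / 2 - Num.sqrt (delta * (1 - delta)).

Definition R0 (R : realType) (r : nat) (delta : R) : R :=
  h2 (tau_of delta) - c_const r.+1 (tau_of delta).

(* Main.v *)
(* Put [w = r + 1]. Each coordinate of a linear code C with locality r lies in the support of a dual word of weight at most w. Shortening C at s n successively chosen repair groups, padded to s n (r + 1) coordinates, costs at most s n r dimensions, so it suffices to bound the size of a code whose dual words of weight at most w cover all coordinates.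

   For such a code, |C| is the number of vertices of the Cayley graph of F_2^n modulo the dual code, whose nontrivial eigenvalues are at most n - 2d. Pushing a positive radial function on the Hamming ball of radius about n tau forward to this graph, a Faber-Krahn argument (Friedman and Tillich) bounds |C| by n times the number of cosets meeting that ball, hence by n times the number of minimal-weight coset representatives of weight at most n tau.

   These representatives are rare (Iceland and Samorodnitsky). If the parts outside a set H of a family of dual words are pairwise disjoint, a minimal-weight y contains at most |H| of these parts, since otherwise adding the corresponding dual words would lower the weight. For a random y with independent bits of bias tau this is exponentially unlikely as soon as the family is large compared with H; if a maximal family is too small, its union is added to H, which shortens every dual word outside H, so that at most w rounds are needed. *)
Require Import Defs.
From mathcomp Require Import all_boot all_order all_algebra.
From mathcomp Require Import all_classical all_reals all_analysis.
From mathcomp Require Import zify ring lra fintype finset.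
Import Order.TTheory GRing.Theory Num.Theory.
Set Implicit Arguments. Unset Strict Implicit. Unset Printing Implicit Defensive.
Local Open Scope ring_scope.

(** * Eigenvalues of the coset graph *)

Section Words.
Variable I : finType.
Implicit Types (x y z c : {set I}) (C : {set {set I}}).

Definition symdiff x y := [set i | (i \in x) (+) (i \in y)].

Lemma symdiffA : associative symdiff.
Proof. by move=> x y z; apply/setP=> i; rewrite !inE addbA. Qed.

Lemma symdiff0 x : symdiff x set0 = x.
Proof. by apply/setP=> i; rewrite !inE addbF. Qed.

Lemma symdiffK y : involutive (symdiff^~ y).
Proof. by move=> x; apply/setP=> i; rewrite !inE -addbA addbb addbF. Qed.

Lemma odd_cardI x c : odd #|x :&: c| = \big[addb/false]_(i in c) (i \in x).
Proof.
rewrite -sum1_card (big_morph odd oddD (erefl : odd 0 = false)) /=.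
rewrite big_mkcond [RHS]big_mkcond /=; apply: eq_bigr => i _.
by rewrite inE; case: (i \in x); case: (i \in c).
Qed.

Lemma odd_symdiffI x y c :
  odd #|symdiff x y :&: c| = odd #|x :&: c| (+) odd #|y :&: c|.
Proof. by rewrite !odd_cardI -big_split; apply: eq_bigr => i _; rewrite inE. Qed.

Definition binary_linear C :=
  set0 \in C /\ {in C &, forall x y, symdiff x y \in C}.

(** Two words have the same syndrome exactly when they differ by a dual word, so syndromes stand for
    the vertices of the coset graph and no quotient has to be formed. *)
Definition syndrome C y := [set c in C | odd #|y :&: c|].

End Words.

Section Spectral.
Variables (R : realFieldType) (I : finType) (C : {set {set I}}).
Hypothesis linC : binary_linear C.
Implicit Types (f g : {set I} -> R) (x y z c : {set I}).

Lemma sqr_sum_le (T : finType) (A : {set T}) (F : T -> R) :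
  (\sum_(i in A) F i) ^+ 2 <= #|A|%:R * \sum_(i in A) F i ^+ 2.
Proof.
have : 0 <= \sum_(i in A) \sum_(j in A) (F i - F j) ^+ 2.
  by do 2![apply: sumr_ge0 => ? _]; rewrite sqr_ge0.
set S := \sum_(i in A) F i; set Q := \sum_(i in A) F i ^+ 2.
suff -> : \sum_(i in A) \sum_(j in A) (F i - F j) ^+ 2 =
    (#|A|%:R * Q - S ^+ 2) *+ 2 by rewrite pmulrn_lge0 // subr_ge0.
have sqE a b : (a - b) ^+ 2 = a ^+ 2 + b ^+ 2 - 2 * a * b :> R by ring.
under eq_bigr => i _.
  under eq_bigr do rewrite sqE.
  rewrite sumrB big_split sumr_const -mulr_sumr -/S -/Q /= -[_ *+ _]mulr_natl; over.
rewrite sumrB big_split sumr_const -mulr_sumr -mulr_suml -mulr_sumr -/S -/Q /=.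
by rewrite -[Q *+ #|A|]mulr_natl; ring.
Qed.

Definition fourier f c : R := \sum_y (-1) ^+ #|y :&: c| * f y.

(** Orthogonality of characters: if a codeword [c0] meets [symdiff y z] in an odd set, translation
    by [c0] permutes [C] and negates every term, so the sum equals its own opposite. *)
Lemma sum_characters y z :
  \sum_(c in C) ((-1) ^+ #|y :&: c| * (-1) ^+ #|z :&: c| : R) =
  (syndrome C y == syndrome C z)%:R * #|C|%:R.
Proof.
have chE c : (-1) ^+ #|y :&: c| * (-1) ^+ #|z :&: c| =
    (-1) ^+ odd #|symdiff y z :&: c| :> R.
  by rewrite odd_symdiffI signr_addb !signr_odd.
have [eq_s|neq_s] := eqVneq.
  rewrite mul1r -sumr_const; apply: eq_bigr => c cC.
  move/setP/(_ c): eq_s; rewrite !inE cC /= chE odd_symdiffI => ->.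
  by rewrite addbb.
rewrite mul0r.
have [c0 c0C odd_c0] : exists2 c, c \in C & odd #|symdiff y z :&: c|.
  apply/exists_inP; apply: contraR neq_s; rewrite negb_exists_in => /forall_inP H.
  apply/eqP/setP=> c; rewrite !inE; case: (boolP (c \in C)) => //= /H.
  by rewrite odd_symdiffI; do 2!case: odd.
set S := \sum_(c in C) _; suff: S = - S.
  by move/eqP; rewrite -subr_eq0 opprK -mulr2n mulrn_eq0 => /eqP.
rewrite {1}/S (reindex_inj (inv_inj (symdiffK c0))) /= -sumrN.
apply: eq_big => c.
  apply/idP/idP => [|cC]; last exact: (linC.2 _ _ cC c0C).
  by move=> /(linC.2 _ _)/(_ c0C); rewrite symdiffK.
by rewrite !chE => _; rewrite [symdiff y z]lock setIC odd_symdiffI -!(setIC (locked _)) 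
  -lock odd_c0 addbT signrN.
Qed.

(** For [c] in [C] the character is constant on cosets of the dual code, so only the pushforwards of
    [f] and [g] to the coset graph are seen; the right side is [#|C|] times their inner product. *)
Lemma parseval f g :
  \sum_(c in C) fourier f c * fourier g c =
  #|C|%:R * \sum_y \sum_(z | syndrome C z == syndrome C y) f y * g z.
Proof.
under eq_bigr do rewrite mulr_suml; rewrite exchange_big mulr_sumr.
apply: eq_bigr => y _; under eq_bigr do rewrite mulr_sumr.
rewrite exchange_big /= mulr_sumr [RHS]big_mkcond /=; apply: eq_bigr => z _.
rewrite (eq_bigr (fun c => (-1) ^+ #|y :&: c| * (-1) ^+ #|z :&: c| * (f y * g z))).
  rewrite -mulr_suml sum_characters eq_sym; case: eqP; rewrite ?mul1r //.
  by rewrite !mul0r.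
by move=> c _; rewrite mulrACA.
Qed.

(** Flipping coordinate [i] changes the sign of the character of [c] exactly when [i] lies in [c];
    summing these signs gives the eigenvalue. *)
Lemma fourier_neighbours f c :
  fourier (fun y => \sum_i f (symdiff y [set i])) c =
  (#|I|%:R - 2 * #|c|%:R) * fourier f c.
Proof.
rewrite /fourier; under eq_bigr do rewrite mulr_sumr; rewrite exchange_big /=.
have signE i y : (-1) ^+ #|symdiff y [set i] :&: c| =
    (1 - 2 * (i \in c)%:R) * (-1) ^+ #|y :&: c| :> R.
  rewrite -signr_odd odd_symdiffI signr_addb signr_odd mulrC; congr (_ * _).
  rewrite signr_odd; case: (boolP (i \in c)) => ic.
    by rewrite (setIidPl _) ?sub1set // cards1 expr1 mulr1; ring.
  suff -> : [set i] :&: c = set0 by rewrite cards0 expr0 mulr0 subr0.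
  by apply/eqP; rewrite setI_eq0 disjoints1.
under eq_bigr => i _.
  rewrite (reindex_inj (inv_inj (symdiffK [set i]))) /=.
  under eq_bigr do rewrite symdiffK signE -mulrA.
  rewrite -mulr_sumr; over.
rewrite -mulr_suml; congr (_ * _).
rewrite sumrB sumr_const -mulr_sumr -natr_sum; congr (_ - _ * _%:R).
by rewrite -sum1_card [RHS]big_mkcond /=; apply: eq_bigr => i _; case: (i \in c).
Qed.

(* Faber-Krahn on the coset graph: a nonnegative function with small support whose adjacency image dominates [lam] times itself forces the graph, which has [#|C|] vertices, to be small. *)
Lemma card_code_le_syndromes f (lam lam2 : R) :
  (forall y, 0 <= f y) -> 0 < f set0 ->
  (forall y, lam * f y <= \sum_i f (symdiff y [set i])) ->
  {in C, forall c, c != set0 -> #|I|%:R - 2 * #|c|%:R <= lam2} ->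
  lam2 <= #|I|%:R ->
  (lam - lam2) * #|C|%:R <=
    (#|I|%:R - lam2) * #|syndrome C @: [set y | f y != 0]|%:R.
Proof.
move=> f_ge0 f0_gt0 f_sub gap lam2_le.
set Af := fun y => \sum_i f (symdiff y [set i]).
set N := #|_ @: _|; set n : R := #|I|%:R in gap lam2_le *.
(* [F] is the pushforward of [f] to cosets, and [W] is [#|C|] times its squared norm. *)
pose F K := \sum_(y | (f y != 0) && (syndrome C y == K)) f y.
pose W := \sum_(c in C) fourier f c * fourier f c.
have C_gt0 : 0 < #|C|%:R :> R.
  by rewrite ltr0n card_gt0; apply/set0Pn; exists set0; exact: linC.1.
have supp_sum (g : {set I} -> R) (P : pred {set I}) :
    \sum_(y | P y) f y * g y = \sum_(y | P y && (f y != 0)) f y * g y.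
  rewrite big_mkcondr; apply: eq_bigr => y _.
  by case: eqP => //= ->; rewrite mul0r.
have suppE (G : {set I} -> R) :
    \sum_(y | f y != 0) G y = \sum_(y in [set y | f y != 0]) G y.
  by apply: eq_bigl => y; rewrite inE.
have WE : W = #|C|%:R * \sum_(K in syndrome C @: [set y | f y != 0]) F K ^+ 2.
  rewrite /W parseval; congr (_ * _).
  under eq_bigr do rewrite -mulr_sumr.
  rewrite supp_sum suppE.
  rewrite (partition_big_imset (syndrome C)); apply: eq_bigr => K _.
  rewrite expr2 {1}/F mulr_suml; apply: eq_big => [y|y /andP[_ /eqP sy]].
    by rewrite inE.
  congr (_ * _); rewrite /F sy.
  rewrite -(eq_bigr _ (fun z _ => mulr1 (f z))) supp_sum.
  by apply: eq_big => [z|z _]; rewrite ?mulr1 // andbC.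
have f0E : fourier f set0 = \sum_(K in syndrome C @: [set y | f y != 0]) F K.
  rewrite /fourier; under eq_bigr do rewrite setI0 cards0 expr0 mulrC.
  rewrite supp_sum suppE.
  rewrite (partition_big_imset (syndrome C)); apply: eq_bigr => K _.
  by apply: eq_big => y; rewrite ?inE ?mulr1.
(* Cauchy-Schwarz over the [N] cosets that carry [F]. *)
have cs : #|C|%:R * fourier f set0 ^+ 2 <= N%:R * W.
  rewrite WE f0E [leRHS]mulrCA; apply: ler_wpM2l; first exact: ltW.
  exact: sqr_sum_le.
have f0_pos : 0 < fourier f set0.
  rewrite /fourier (bigD1 set0) //= setI0 cards0 expr0 mul1r ltr_wpDr //.
  by apply: sumr_ge0 => y _; rewrite setI0 cards0 expr0 mul1r.
have WD : W = fourier f set0 ^+ 2 + \sum_(c in C | c != set0) fourier f c ^+ 2.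
  by rewrite /W (bigD1 set0) ?linC.1 //=.
have W_gt0 : 0 < W.
  rewrite WD ltr_wpDr ?exprn_gt0 //.
  by apply: sumr_ge0 => c _; rewrite sqr_ge0.
(* By Parseval the right side is [#|C|] times the inner product of the pushforwards of [f] and [Af];
   since [f] is nonnegative, [f_sub] applies term by term. *)
have low : lam * W <= \sum_(c in C) (n - 2 * #|c|%:R) * fourier f c ^+ 2.
  rewrite (eq_bigr (fun c => fourier f c * fourier Af c)); last first.
    by move=> c _; rewrite /Af fourier_neighbours expr2 mulrCA.
  rewrite /W !parseval mulrCA ler_pM2l // mulr_sumr; apply: ler_sum => y _.
  rewrite mulr_sumr; apply: ler_sum => z _.
  by rewrite mulrCA; apply: ler_wpM2l => //; exact: f_sub.
(* Only the zero word escapes the gap; its eigenvalue is [n]. *)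
have up : \sum_(c in C) (n - 2 * #|c|%:R) * fourier f c ^+ 2 <=
    n * fourier f set0 ^+ 2 + lam2 * (W - fourier f set0 ^+ 2).
  rewrite (bigD1 set0) ?linC.1 //= cards0 mulr0 subr0 lerD2l WD.
  rewrite [X in _ * X]addrC addKr mulr_sumr; apply: ler_sum => c /andP[cC c0].
  by apply: ler_wpM2r; rewrite ?sqr_ge0 ?gap.
have main : (lam - lam2) * W <= (n - lam2) * fourier f set0 ^+ 2.
  by move: (le_trans low up); rewrite mulrBr !mulrBl; lra.
rewrite -(ler_pM2r W_gt0).
apply: (@le_trans _ _ ((n - lam2) * (#|C|%:R * fourier f set0 ^+ 2))).
  by rewrite mulrAC mulrC [leRHS]mulrCA ler_pM2l.
by rewrite -[leRHS]mulrA; apply: ler_wpM2l => //; rewrite subr_ge0.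
Qed.

End Spectral.

(** * Radial functions on Hamming balls *)

Section Radial.
Variable R : realFieldType.

Lemma sum_neighbours_radial (I : finType) (g : nat -> R) (y : {set I}) :
  \sum_i g #|symdiff y [set i]| =
  #|y|%:R * g #|y|.-1 + (#|I| - #|y|)%:R * g #|y|.+1.
Proof.
have inE1 i : i \in y -> #|symdiff y [set i]| = #|y|.-1.
  move=> iy; rewrite (cardsD1 i y) iy; congr #|pred_of_set _|.
  by apply/setP=> j; rewrite !inE; case: eqP => [->|_]; rewrite ?iy ?addbF ?andbT.
have notinE i : i \notin y -> #|symdiff y [set i]| = #|y|.+1.
  move=> iy; have <- : #|i |: y| = #|y|.+1 by rewrite cardsU1 iy.
  congr #|pred_of_set _|.
  apply/setP=> j; rewrite !inE; case: eqP => [->|_]; rewrite ?addbF //.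
  by rewrite (negbTE iy).
rewrite (bigID (mem y)) /=; congr (_ + _).
  rewrite (eq_bigr (fun=> g #|y|.-1)) => [|i /inE1-> //].
  by rewrite sumr_const mulr_natl.
rewrite (eq_bigr (fun=> g #|y|.+1)) => [|i /notinE-> //].
rewrite sumr_const mulr_natl; congr (_ *+ _).
have <- : #|~: y| = (#|I| - #|y|)%N by rewrite cardsCs setCK.
by apply: eq_card => i; rewrite !inE.
Qed.

Variables (n : nat) (lam : R).

(* [radial] solves [lam * g k = k * g k.-1 + (n - k) * g k.+1] for [k < n], with [g 0 = 1]. *)
Fixpoint radial_pair k : R * R :=
  if k is k'.+1 then
    let: (a, b) := radial_pair k' in
    (b, (lam * b - k%:R * a) / (n - k)%:R)
  else (1, lam / n%:R).

Definition radial k := (radial_pair k).1.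

Lemma radial1 : radial 1 = lam / n%:R.
Proof. by []. Qed.

Lemma radialSS k :
  radial k.+2 = (lam * radial k.+1 - k.+1%:R * radial k) / (n - k.+1)%:R.
Proof.
by rewrite /radial /=; case: (radial_pair k).
Qed.

(* While [radial] stays positive, the ratio of consecutive values drops by at least [eps] at each step of the window. *)
Lemma radial_ratio_step (eps : R) k : (k.+1 < n)%N ->
  (lam + eps * n%:R) ^+ 2 <= 4 * k.+1%:R * (n%:R - k.+1%:R) ->
  0 < eps -> 0 < radial k -> 0 < radial k.+1 ->
  radial k.+2 / radial k.+1 <= radial k.+1 / radial k - eps.
Proof.
move=> kn disc eps_gt0 a_gt0 b_gt0; rewrite radialSS natrB 1?ltnW //.
set a := radial k in a_gt0 *; set b := radial k.+1 in b_gt0 *.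
set K : R := k.+1%:R in disc *.
have D_gt0 : 0 < n%:R - K by rewrite subr_gt0 ltr_nat.
have K_gt0 : 0 < K by rewrite ltr0n.
set D := n%:R - K in disc D_gt0 *.
pose u := b / a; have u_gt0 : 0 < u by exact: divr_gt0.
have -> : b = u * a by rewrite /u divfK ?gt_eqF.
have -> : (lam * (u * a) - K * a) / D / (u * a) = (lam * u - K) / (D * u).
  by field; rewrite !gt_eqF.
rewrite mulfK ?gt_eqF // ler_pdivrMr; last exact: mulr_gt0.
have nE : n%:R = D + K by rewrite /D subrK.
(* The hypothesis on [lam + eps * n%:R] says that this quadratic in the ratio [u] has nonpositive
   discriminant. The claim is the same inequality with [eps * D] in place of [eps * (D + K)], hence
   weaker. *)
have quad : 0 <= D * u ^+ 2 - (lam + eps * n%:R) * u + K.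
  move: disc; set L := (lam + _) => disc.
  rewrite -(pmulr_rge0 _ (_ : 0 < 4 * D)) ?mulr_gt0 //.
  have -> : 4 * D * (D * u ^+ 2 - L * u + K) =
      (2 * D * u - L) ^+ 2 + (4 * K * D - L ^+ 2) by ring.
  by rewrite addr_ge0 ?sqr_ge0 // subr_ge0.
move: quad; rewrite nE.
have : 0 <= eps * K * u by apply: mulr_ge0; [apply: mulr_ge0|]; exact: ltW.
lra.
Qed.

(** If all these values were positive, the ratio of consecutive ones would be at most 2 when the
    window opens, lose [eps] per step, and be at most 0 after [rho - k0] steps. *)
Lemma radial_not_positive (k0 rho : nat) (eps : R) :
  0 < lam -> 0 < eps -> (0 < k0)%N -> (k0 <= rho)%N -> (k0.*2 <= n)%N ->
  (rho < n)%N ->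
  (forall k, (k0 <= k <= rho)%N ->
     (lam + eps * n%:R) ^+ 2 <= 4 * k%:R * (n%:R - k%:R)) ->
  2 <= eps * (rho - k0)%:R ->
  exists2 k, (k <= rho)%N & radial k.+1 <= 0.
Proof.
move=> lam_gt0 eps_gt0 k0_gt0 k0rho k0n rhon disc window.
have n_gt0 : 0 < n%:R :> R by rewrite ltr0n (leq_ltn_trans _ rhon).
have [/existsP[k]|] := boolP [exists k : 'I_rho.+1, radial k.+1 <= 0].
  by exists k => //; rewrite -ltnS.
rewrite negb_exists => /forallP H.
have pos k : (k <= rho.+1)%N -> 0 < radial k.
  case: k => [|k] kr; first by rewrite ltr01.
  by have := H (Ordinal kr); rewrite -ltNge.
have lam_le : lam <= n%:R.
  have k0d : (k0 <= k0 <= rho)%N by rewrite leqnn.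
  have := disc _ k0d; set x : R := k0%:R => Hx.
  have : (lam + eps * n%:R) ^+ 2 <= n%:R ^+ 2.
    by apply: (le_trans Hx); have := sqr_ge0 (n%:R - 2 * x); lra.
  rewrite ler_sqr ?nnegrE ?addr_ge0 ?mulr_ge0 //; try exact: ltW.
  by apply: le_trans; rewrite lerDl mulr_ge0 // ltW.
have [k0' k0E] : exists k0', k0 = k0'.+1 by case: k0 k0_gt0 {k0rho k0n disc window} => // k _; exists k.
(* Dropping the negative term of the recurrence leaves the ratio at most [lam / (n - k0')], where
   [lam <= n] and [n - k0'] is at least half of [n]. *)
have start : radial k0'.+1 / radial k0' <= 2.
  rewrite ler_pdivrMr; last by apply: pos; lia.
  case: k0' k0E => [|k] k0E.
    rewrite radial1 mulr1 ler_pdivrMr //; lra.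
  have kn : (k.+1 < n)%N by lia.
  have D_gt0 : 0 < (n - k.+1)%:R :> R by rewrite ltr0n subn_gt0.
  rewrite radialSS ler_pdivrMr //.
  have p1 : 0 < radial k.+1 by apply: pos; lia.
  have p0 : 0 <= k.+1%:R * radial k.
    by apply: mulr_ge0 => //; apply/ltW/pos; lia.
  rewrite lerBlDr; apply: (@le_trans _ _ (lam * radial k.+1 + 0)).
    by rewrite addr0.
  apply: lerD => //; rewrite mulrAC ler_pM2r //; apply: (le_trans lam_le).
  by rewrite -natrM ler_nat; lia.
have drop m : (k0' + m <= rho)%N ->
    radial (k0' + m).+1 / radial (k0' + m) <= 2 - m%:R * eps.
  elim: m => [|m IH] mr; first by rewrite addn0 mul0r subr0; exact: start.
  rewrite addnS; apply: le_trans (radial_ratio_step _ (disc _ _) eps_gt0 _ _) _; rewrite ?pos //; try lia.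
  have := IH ltac:(lia); rewrite -natr1; lra.
have := drop (rho - k0)%N ltac:(lia).
have : 0 < radial (k0' + (rho - k0)).+1 / radial (k0' + (rho - k0)).
  by rewrite divr_gt0 ?pos //; lia.
by lra.
Qed.

(** Cut [radial] off just before its first nonpositive value. At the cut, zero replaces a
    nonpositive neighbour, which turns the recurrence into an inequality in the wanted direction. *)
Lemma radial_supersolution (k0 rho : nat) (eps : R) :
  0 < lam -> 0 < eps -> (0 < k0)%N -> (k0 <= rho)%N -> (k0.*2 <= n)%N ->
  (rho < n)%N ->
  (forall k, (k0 <= k <= rho)%N ->
     (lam + eps * n%:R) ^+ 2 <= 4 * k%:R * (n%:R - k%:R)) ->
  2 <= eps * (rho - k0)%:R ->
  exists g : nat -> R, [/\ forall k, 0 <= g k, 0 < g 0%N,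
    forall k, (rho < k)%N -> g k = 0 &
    forall k, lam * g k <= k%:R * g k.-1 + (n - k)%:R * g k.+1].
Proof.
move=> lam_gt0 eps_gt0 k0_gt0 k0rho k0n rhon disc window.
have ex : exists k, radial k.+1 <= 0.
  by have [k _] := radial_not_positive lam_gt0 eps_gt0 k0_gt0 k0rho k0n rhon disc window; exists k.
case: (ex_minnP ex) => j j0 minj.
have jrho : (j <= rho)%N.
  have [k kr /minj] := radial_not_positive lam_gt0 eps_gt0 k0_gt0 k0rho k0n rhon disc window.
  by move=> jk; exact: leq_trans jk kr.
have pos k : (k <= j)%N -> 0 < radial k.
  case: k => [|k] kj; first by rewrite ltr01.
  by rewrite ltNge; apply/negP => /minj; rewrite leqNgt kj.
have recE k : (k < n)%N -> lam * radial k = k%:R * radial k.-1 + (n - k)%:R * radial k.+1.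
  move=> kn; have D0 : (n - k)%:R != 0 :> R by rewrite pnatr_eq0 subn_eq0 -ltnNge.
  case: k kn D0 => [|k] kn D0.
    rewrite mul0r add0r radial1 [RHS]mulrC subn0 divfK ?mulr1 //.
    by rewrite subn0 in D0.
  by rewrite radialSS [_ * (_ / _)]mulrC divfK //= addrC subrK.
exists (fun k => if (k <= j)%N then radial k else 0); split=> [k||k kr|k].
- by case: leqP => // /pos/ltW.
- exact: ltr01.
- by rewrite leqNgt (leq_ltn_trans jrho kr).
- have [kj|kj] := leqP k j; last first.
    rewrite mulr0 addr_ge0 ?mulr_ge0 //; case: leqP => // /pos/ltW //.
  rewrite (leq_trans (leq_pred k) kj) recE; last by lia.
  rewrite lerD2l; have [_|jk] := ltnP k j; first by [].
  have -> : k = j by lia.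
  by rewrite mulr0 mulr_ge0_le0.
Qed.

End Radial.

(** * Minimal-weight coset representatives *)

Section BiasedMass.
Variables (R : realType) (I : finType) (p : R).
Implicit Types (y S B : {set I}) (P : {set {set I}}).

Definition biased_mass y : R := \prod_i (if i \in y then p else 1 - p).

Lemma biased_massE y :
  biased_mass y = p ^+ #|y| * (1 - p) ^+ (#|I| - #|y|).
Proof.
rewrite /biased_mass (bigID (mem y)) /=; congr (_ * _).
  rewrite (eq_bigr (fun=> p)) => [|i -> //]; by rewrite prodr_const.
rewrite (eq_bigr (fun=> 1 - p)) => [|i /negbTE-> //].
rewrite prodr_const; congr (_ ^+ _).
have <- : #|~: y| = (#|I| - #|y|)%N by rewrite cardsCs setCK.
by apply: eq_card => i; rewrite !inE.
Qed.

Lemma biased_mass_ge0 y : 0 <= p <= 1 -> 0 <= biased_mass y.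
Proof.
by move=> /andP[p0 p1]; apply: prodr_ge0 => i _; case: ifP; rewrite ?subr_ge0.
Qed.

Lemma biased_mass_superset S : \sum_(y : {set I} | S \subset y) biased_mass y = p ^+ #|S|.
Proof.
transitivity (\prod_i (p + (if i \in S then 0 else 1 - p))); last first.
  rewrite -prodr_const [RHS]big_mkcond /=; apply: eq_bigr => i _.
  by case: (i \in S); rewrite ?addr0 // addrC subrK.
rewrite bigA_distr big_mkcond /=; apply: eq_bigr => y _.
case: (boolP (S \subset y)) => [Sy|/subsetPn[i iS iy]].
  apply: eq_bigr => i _; case: (boolP (i \in y)) => // iy.
  by case: (boolP (i \in S)) => // /(subsetP Sy); rewrite (negbTE iy).
by rewrite (bigD1 i) //= (negbTE iy) iS mul0r.
Qed.

(** Disjoint blocks are independent, so the expectation is a product. The factor of a block [B] is 1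
    minus half the indicator of [B \subset y]; the second term adds [B] to [S], which is why the
    induction carries a general [S]. *)
Lemma biased_mass_blocks P S : trivIset P -> [disjoint S & cover P] ->
  \sum_(y : {set I} | S \subset y) biased_mass y * \prod_(B in P) (if B \subset y then 2^-1 else 1)
  = p ^+ #|S| * \prod_(B in P) (1 - p ^+ #|B| / 2).
Proof.
have [m] := ubnP #|P|; elim: m => // m IH in P S * => Pm tP dSP.
have [->|[B BP]] := set_0Vmem P.
  rewrite big_set0 mulr1 -biased_mass_superset; apply: eq_bigr => y _.
  by rewrite big_set0 mulr1.
have P'm : (#|P :\ B| < m)%N by move: Pm; rewrite (cardsD1 B) BP.
have tP' : trivIset (P :\ B) by apply: trivIsetS tP; exact: subsetDl.
have cP : cover P = B :|: cover (P :\ B).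
  rewrite /cover -{1}(setD1K BP) big_setU1 // ?inE ?eqxx //.
have dBP : [disjoint B & cover (P :\ B)].
  apply/bigcup_disjointP => B'; rewrite !inE => /andP[B'B B'P].
  by move/trivIsetP: tP; apply; rewrite // eq_sym.
have [dSB dSP'] : [disjoint S & B] /\ [disjoint S & cover (P :\ B)].
  by move: dSP; rewrite cP -!setI_eq0 setIUr setU_eq0 => /andP[].
have dSBP' : [disjoint S :|: B & cover (P :\ B)].
  by rewrite -setI_eq0 setIUl setU_eq0 !setI_eq0 dSP' dBP.
have eS := IH _ _ P'm tP' dSP'; have eSB := IH _ _ P'm tP' dSBP'.
rewrite (big_setD1 B) //=.
under eq_bigr do rewrite (big_setD1 B) //=.
transitivity (\sum_(y : {set I} | S \subset y) biased_mass y * (\prod_(B' in P :\ B) (if B' \subset y then 2^-1 else 1))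
  - 2^-1 * \sum_(y : {set I} | S :|: B \subset y) biased_mass y * (\prod_(B' in P :\ B) (if B' \subset y then 2^-1 else 1))).
  rewrite mulr_sumr [X in _ - X]big_mkcond [X in X - _]big_mkcond [LHS]big_mkcond -sumrB /=.
  apply: eq_bigr => y _; rewrite subUset; case: (S \subset y); last by rewrite subr0.
  by case: (B \subset y) => /=; [field|rewrite subr0 mul1r].
rewrite eS eSB cardsU disjoint_setI0 // cards0 subn0 exprD; ring.
Qed.

(** Exponential Markov inequality: on [D], [2 ^+ a] times one factor 1/2 per contained block is at
    least 1. *)
Lemma biased_mass_few_blocks (D : {pred {set I}}) P (a : nat) : 0 <= p <= 1 ->
  trivIset P -> {in D, forall y, (#|[set B in P | B \subset y]| <= a)%N} ->
  \sum_(y in D) biased_mass y <= 2 ^+ a * \prod_(B in P) (1 - p ^+ #|B| / 2).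
Proof.
move=> p01 tP few; have := @biased_mass_blocks P set0 tP.
rewrite -setI_eq0 set0I eqxx cards0 expr0 mul1r => /(_ isT) <-.
under [X in _ * X]eq_bigl do rewrite sub0set.
rewrite mulr_sumr big_mkcond; apply: ler_sum => y _.
have prodE : \prod_(B in P) (if B \subset y then 2^-1 else 1 : R) =
    2 ^- #|[set B in P | B \subset y]|.
  rewrite -big_mkcondr -exprVn -prodr_const /=.
  by apply: eq_bigl => B; rewrite !inE.
rewrite prodE; case: ifP => [/few yD|_].
  rewrite mulrCA ler_peMr ?biased_mass_ge0 // -expfB_cond ?pnatr_eq0 ?eqxx //.
  by rewrite exprn_ege1 // ler1n.
by rewrite mulr_ge0 ?exprn_ge0 // mulr_ge0 ?biased_mass_ge0 ?invr_ge0 ?exprn_ge0.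
Qed.

End BiasedMass.

(** * Cosets of the dual code and their minimal-weight words *)

Section Leaders.
Variables (I : finType) (C : {set {set I}}).
Implicit Types (x y z c h H B : {set I}) (P Q J : {set {set I}}).

Definition dual_word h := [forall c in C, ~~ odd #|h :&: c|].

Lemma syndrome_symdiff_dual y h :
  dual_word h -> syndrome C (symdiff y h) = syndrome C y.
Proof.
move=> /forall_inP hC; apply/setP=> c; rewrite !inE odd_symdiffI.
by case: (boolP (c \in C)) => //= /hC/negbTE->; rewrite addbF.
Qed.

Definition leader y :=
  [forall z, (syndrome C z == syndrome C y) ==> (#|y| <= #|z|)%N].

Lemma leader_exists y :
  exists z, [/\ leader z, syndrome C z = syndrome C y & (#|z| <= #|y|)%N].
Proof.
case: (@arg_minnP _ y (fun z => syndrome C z == syndrome C y) (fun z => #|z|)) => //.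
move=> z /eqP zy minz; exists z; split=> //; last exact: minz.
by apply/forallP => t; apply/implyP; rewrite zy => /minz.
Qed.

Lemma symdiff_blocks H J y : trivIset J ->
  {in J, forall B, exists2 h, dual_word h & B = h :\: H} ->
  exists2 z, syndrome C z = syndrome C y &
    z :\: H = symdiff (y :\: H) (cover J).
Proof.
have [m] := ubnP #|J|; elim: m => // m IH in J * => Jm tJ JH.
have [->|[B BJ]] := set_0Vmem J.
  by exists y => //; rewrite /cover big_set0 symdiff0.
have J'm : (#|J :\ B| < m)%N by move: Jm; rewrite (cardsD1 B) BJ.
have tJ' : trivIset (J :\ B) by apply: trivIsetS tJ; exact: subsetDl.
have J'H : {in J :\ B, forall B, exists2 h, dual_word h & B = h :\: H}.
  by move=> B'; rewrite !inE => /andP[_ /JH].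
have [z zy zE] := IH _ J'm tJ' J'H; have [h hC BE] := JH _ BJ.
exists (symdiff z h); first by rewrite syndrome_symdiff_dual.
have -> : symdiff z h :\: H = symdiff (z :\: H) (h :\: H).
  by apply/setP=> i; rewrite !inE; case: (i \in H).
rewrite zE -BE -symdiffA; congr symdiff.
have dBJ : [disjoint B & cover (J :\ B)].
  apply/bigcup_disjointP => B'; rewrite !inE => /andP[B'B B'J].
  by move/trivIsetP: tJ; apply; rewrite // eq_sym.
rewrite {2}/cover -{2}(setD1K BJ) big_setU1 ?inE ?eqxx //= -/(cover _).
apply/setP=> i; rewrite !inE addbC; case: (boolP (i \in B)) => //= iB.
by rewrite (disjointFr dBJ iB).
Qed.

(* Adding to [y] the dual words of all the blocks it contains removes these blocks and changes nothing else outside [H]. *)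
Lemma leader_few_blocks H P y : leader y -> trivIset P -> set0 \notin P ->
  {in P, forall B, exists2 h, dual_word h & B = h :\: H} ->
  (#|[set B in P | B \subset y]| <= #|H|)%N.
Proof.
move=> /forallP lead tP P0 PH; set J := [set B in P | B \subset y].
have JP : J \subset P by apply/subsetP=> B; rewrite inE => /andP[].
have tJ := trivIsetS JP tP.
have [z zy zE] := symdiff_blocks y tJ (fun B BJ => PH B (subsetP JP B BJ)).
have cJ : cover J \subset y :\: H.
  apply/bigcupsP => B; rewrite inE => /andP[/PH[h _ ->] hy].
  by apply/subsetP=> i ih; rewrite inE (subsetP hy) // andbT; move: ih; rewrite inE => /andP[].
have Jcard : (#|J| <= #|cover J|)%N.
  move/eqP: tJ => <-; rewrite -sum1_card; apply: leq_sum => B BJ.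
  by rewrite card_gt0; apply: contraNneq P0 => <-; exact: subsetP JP _ BJ.
have zH : z :\: H = (y :\: H) :\: cover J.
  rewrite zE; apply/setP=> i; rewrite [LHS]inE [RHS]inE.
  by have := subsetP cJ i; case: (i \in cover J) => /= [->//|_]; rewrite addbF.
have yz : (#|y| <= #|z|)%N by move/implyP: (lead z); apply; rewrite zy.
(* Inside [H] the word [z] has weight at most [#|H|]; outside it has lost [#|cover J|], which is at
   least [#|J|]. Minimality of [y] compares the two. *)
have := cardsID H z; have := cardsID H y; have := subset_leq_card (subsetIr z H).
have := cardsID (cover J) (y :\: H); rewrite -zH (setIidPr cJ).
lia.
Qed.

Lemma max_disjoint_blocks Q : set0 \notin Q ->
  exists P, [/\ P \subset Q, trivIset P &
    {in Q, forall B, ~~ [disjoint B & cover P]}].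
Proof.
move=> Q0; have t0 : (set0 \subset Q) && trivIset (set0 : {set {set I}}).
  by rewrite sub0set; apply/trivIsetP=> A B; rewrite inE.
have [P /maxsetP[/andP[PQ tP] maxP] _] := @maxset_exists _ (fun P => (P \subset Q) && trivIset P) _ t0.
exists P; split=> // B BQ; apply/negP => dB.
have B0 : B != set0 by apply: contraNneq Q0 => <-.
have BP : B \notin P.
  apply: contra B0 => BP; move: dB; rewrite -setI_eq0 (setIidPl _) //.
  exact: (bigcup_sup B).
have dBP B' : B' \in P -> [disjoint B & B'].
  by move=> B'P; move/bigcup_disjointP: dB; apply.
have := maxP (B |: P); rewrite subUset sub1set BQ PQ subsetUr => H.
have tBP : trivIset (B |: P).
  apply/trivIsetP => A A'; rewrite !inE => /orP[/eqP->|AP] /orP[/eqP->|A'P].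
  - by rewrite eqxx.
  - by move=> _; exact: dBP.
  - by move=> _; rewrite disjoint_sym; exact: dBP.
  - by move/trivIsetP: tP; apply.
by move: BP; rewrite -(H tBP isT) !inE eqxx.
Qed.

End Leaders.

(** * Exponential rarity of minimal-weight words *)

Section LeaderMass.
Variable R : realType.

(* Each round either yields enough disjoint blocks outside [H] or enlarges [H] by a bounded factor while shortening every [h :\: H]. *)
Lemma leader_mass_rounds (I : finType) (C Hs : {set {set I}}) (p x : R) (l : nat)
    (H : {set I}) (a : R) :
  0 < p <= 1 -> {in Hs, forall h, dual_word C h} -> cover Hs = setT ->
  {in Hs, forall h, (#|h :\: H| <= l)%N} ->
  0 <= x <= a -> #|H|%:R <= a ->
  a * \prod_(j < l) (1 + 4 * j.+1%:R / p ^+ j.+1) < #|I|%:R ->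
  \sum_(y | leader C y) biased_mass p y <= expR (- x).
Proof.
move=> /andP[p0 p1] HsC covHs; have p01 : 0 <= p <= 1 by rewrite ltW.
elim: l H a => [|l IH] H a Hl /andP[x0 xa] Ha.
  (* With [l = 0] every word of [Hs] lies inside [H], so [H] is the whole of [I], against the size
     hypothesis. *)
  rewrite big_ord0 mulr1 => /(le_lt_trans Ha); suff -> : H = setT by rewrite cardsT ltxx.
  apply/eqP; rewrite -subTset -covHs; apply/bigcupsP => h hHs.
  by rewrite -setD_eq0 -cards_eq0 -leqn0 Hl.
rewrite big_ord_recr /=; set Pr := \prod_(j < l) _ => aI.
pose Q := [set h :\: H | h in Hs] :\ set0.
have Q0 : set0 \notin Q by rewrite !inE eqxx.
have QE B : B \in Q -> exists2 h, h \in Hs & B = h :\: H.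
  by rewrite inE => /andP[_ /imsetP].
have [P [PQ tP maxP]] := max_disjoint_blocks Q0.
have Psize B : B \in P -> (#|B| <= l.+1)%N.
  by move=> /(subsetP PQ)/QE[h hHs ->]; exact: Hl.
set q := p ^+ l.+1 in aI; have q0 : 0 < q by rewrite exprn_gt0.
have [big_P|small_P] := lerP (4 * a) (#|P|%:R * q).
  have few : {in leader C, forall y : {set I}, (#|[set B in P | B \subset y]| <= #|H|)%N}.
    move=> y ly; apply: leader_few_blocks ly tP _ _; first by apply: contra Q0; exact: subsetP.
    by move=> B /(subsetP PQ)/QE[h hHs ->]; exists h => //; exact: HsC.
  apply: le_trans (biased_mass_few_blocks p01 tP few) _.
  have prod_le : \prod_(B in P) (1 - p ^+ #|B| / 2) <= expR (- (q / 2)) ^+ #|P|.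
    rewrite -prodr_const; apply: ler_prod => B /Psize Bl.
    have pB1 : p ^+ #|B| <= 1 by rewrite exprn_ile1 // ltW.
    have qB : q <= p ^+ #|B| by rewrite ler_wiXn2l // ltW.
    apply/andP; split; first lra.
    by apply: le_trans (expR_ge1Dx _); lra.
  (* With 2 weakened to e, the exponent is [#|H| - q * #|P| / 2], at most [a - 2 * a] by [big_P],
     hence at most [- x]. *)
  apply: (@le_trans _ _ (expR 1 ^+ #|H| * expR (- (q / 2)) ^+ #|P|)).
    apply: ler_pM => //.
      apply: prodr_ge0 => B _.
      have pB1 : p ^+ #|B| <= 1 by rewrite exprn_ile1 // ltW.
      by rewrite subr_ge0 ler_pdivrMr // mul1r (le_trans pB1) // ler1n.
    by apply: lerXn2r; rewrite ?nnegrE ?expR_ge0 //; apply: le_trans (expR_ge1Dx _).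
  rewrite -[expR 1 ^+ _]expRM_natl -[expR _ ^+ #|P|]expRM_natl -expRD ler_expR; move: #|P|%:R #|H|%:R big_P Ha {prod_le few aI} => u v; lra.
(* A small maximal family is absorbed: its union has at most [#|P| * l.+1] elements, and by
   maximality every nonempty [h :\: H] meets it, so the length bound drops to [l]. *)
apply: (IH (H :|: cover P) (a * (1 + 4 * l.+1%:R / q))) => [h hHs|||].
- have [h0|h0] := eqVneq (h :\: H) set0.
    suff -> : h :\: (H :|: cover P) = set0 by rewrite cards0.
    by rewrite -setDDl h0 set0D.
  have hQ : h :\: H \in Q by rewrite in_setD1 h0 /=; apply/imsetP; exists h.
  rewrite -ltnS; apply: leq_trans (Hl _ hHs); apply: proper_card.
  rewrite -setDDl properE subsetDl /=; apply: contra (maxP _ hQ).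
  by rewrite subsetD => /andP[].
- rewrite x0 (le_trans xa) // ler_peMr ?(le_trans x0) // lerDl.
  by rewrite divr_ge0 ?mulr_ge0 // ltW.
- have cP : (#|cover P| <= #|P| * l.+1)%N.
    by move/eqP: tP => <-; rewrite -sum_nat_const; apply: leq_sum => B /Psize.
  have : (#|H :|: cover P| <= #|H| + #|P| * l.+1)%N.
    by apply: leq_trans (leq_add (leqnn _) cP); rewrite cardsU leq_subr.
  rewrite -(ler_nat R) natrD natrM => /le_trans; apply.
  rewrite mulrDr mulr1 lerD //.
  have -> : a * (4 * l.+1%:R / q) = 4 * a / q * l.+1%:R by field; rewrite gt_eqF.
  by rewrite ler_wpM2r // ler_pdivlMr // ltW.
- by rewrite -mulrA (mulrC (1 + _)).
Qed.

(* [c(w, p)] in nats, that is, multiplied by [ln 2]. *)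
Definition leader_exponent (w : nat) (p : R) : R :=
  (p ^+ w / 2) ^+ w.+1 / (8 * (w ^ 2)%:R).

(** The exponent [w * w.+1] is the sum of [2 * j.+1] over [j < w], so each factor gets its own power
    of [p]. As [p <= 1 / 2], the factor with its power is at most [(1 + 4 * j.+1) / 2 ^+ j.+1]: this
    is 5/2 and 9/4 for the first two, whence the constant 3/2, and at most 2 afterwards. *)
Lemma rounds_factor_le (w : nat) (p : R) : 0 < p <= 1 / 2 ->
  p ^+ (w * w.+1) * \prod_(j < w) (1 + 4 * j.+1%:R / p ^+ j.+1) <= 3 / 2 * 2 ^+ w.
Proof.
move=> /andP[p0 p2].
pose G w := p ^+ (w * w.+1) * \prod_(j < w) (1 + 4 * j.+1%:R / p ^+ j.+1).
have G0 k : 0 <= G k.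
  apply: mulr_ge0; first by rewrite exprn_ge0 // ltW.
  by apply: prodr_ge0 => j _; rewrite addr_ge0 // divr_ge0 ?exprn_ge0 ?mulr_ge0 // ltW.
have GS k : G k.+1 <= G k * ((1 + 4 * k.+1%:R) / 2 ^+ k.+1).
  have -> : G k.+1 = G k * (p ^+ k.+1 * (p ^+ k.+1 + 4 * k.+1%:R)).
    rewrite /G big_ord_recr /= (_ : (k.+1 * k.+2 = k * k.+1 + k.+1 + k.+1)%N); last by lia.
    by rewrite !exprD; field; rewrite expf_neq0 // gt_eqF.
  apply: ler_wpM2l => //; rewrite [leRHS]mulrC -exprVn.
  have pk : p ^+ k.+1 <= 2^-1 ^+ k.+1 by apply: lerXn2r; rewrite ?nnegrE; lra.
  have pk1 : p ^+ k.+1 <= 1 by rewrite exprn_ile1 ?ltW //; lra.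
  apply: ler_pM => //; first by rewrite exprn_ge0 // ltW.
    by rewrite addr_ge0 ?mulr_ge0 // exprn_ge0 // ltW.
  by rewrite lerD2r.
have b0 : G 0%N <= 1 by rewrite /G mul0n expr0 big_ord0 mulr1.
have b1 : G 1%N <= 5 / 2 by have := GS 0%N; lra.
have b2 : G 2%N <= 6 by have := GS 1%N; rewrite expr2; lra.
case: w => [|[|w]]; rewrite -/(G _); [by rewrite expr0; lra|by rewrite expr1; lra|].
elim: w => [|w IH]; first by rewrite expr2; lra.
apply: le_trans (GS _) _; rewrite [in leRHS]exprS [leRHS]mulrCA [leRHS]mulrC.
apply: ler_pM => //.
rewrite ler_pdivrMr ?exprn_gt0 //.
have : (1 + 4 * w.+3 <= 2 * 2 ^ w.+3)%N by elim: w {IH} => // w; rewrite !expnS; lia.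
by rewrite -(ler_nat R) natrD [in leRHS]natrM natrX natrM.
Qed.

(** The rounds start from [H = set0] with [a] equal to [#|I|] times [leader_exponent], which is
    small enough that [w] enlargements cannot exhaust the coordinates. *)
Lemma leader_mass (I : finType) (C Hs : {set {set I}}) (w : nat) (p : R) :
  0 < p <= 1 / 2 -> (0 < w)%N -> (0 < #|I|)%N ->
  {in Hs, forall h, dual_word C h} -> cover Hs = setT ->
  {in Hs, forall h : {set I}, (#|h| <= w)%N} ->
  \sum_(y | leader C y) biased_mass p y <= expR (- (#|I|%:R * leader_exponent w p)).
Proof.
move=> p02 w0 I0 HsC covHs Hw; have /andP[p0 p2] := p02.
have e0 : 0 <= leader_exponent w p.
  by rewrite divr_ge0 ?exprn_ge0 ?divr_ge0 ?exprn_ge0 ?mulr_ge0 // ltW.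
apply: (@leader_mass_rounds I C Hs p _ w set0 (#|I|%:R * leader_exponent w p)) => //.
- by rewrite p0; lra.
- by move=> h /Hw; rewrite setD0.
- by rewrite mulr_ge0 ?lexx.
- by rewrite cards0 mulr_ge0.
rewrite -mulrA gtr_pMr ?ltr0n //.
have := rounds_factor_le w p02; set Pr := \prod_(j < w) _ => rf.
have w8 : 8 <= 8 * (w ^ 2)%:R :> R by rewrite ler_peMr // ler1n expn_gt0 w0.
have -> : leader_exponent w p * Pr = (p ^+ (w * w.+1) * Pr) / (2 ^+ w.+1 * (8 * (w ^ 2)%:R)).
  rewrite /leader_exponent expr_div_n -exprM [in RHS]invfM [RHS]mulrA [LHS]mulrAC.
  by congr (_ / _); exact: mulrAC.
rewrite ltr_pdivrMr ?mulr_gt0 ?exprn_gt0 ?ltr0n ?expn_gt0 ?w0 //.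
rewrite mul1r; apply: (le_lt_trans rf); rewrite exprS.
have : 0 < 2 ^+ w :> R by rewrite exprn_gt0.
by move: w8; set W := 8 * _; set T := 2 ^+ w; nra.
Qed.

(** Binary entropy measured in nats. *)
Definition nat_entropy (p : R) : R := - (p * ln p) - (1 - p) * ln (1 - p).

(** As [p <= 1 - p], the mass decreases with the weight, and the bound is its value at weight
    [p * #|I|%:R]. At [p = 1 / 2] all words have equal mass, so no weight condition is imposed
    there. *)
Lemma biased_mass_ge (I : finType) (p : R) (y : {set I}) : 0 < p <= 1 / 2 ->
  (#|y|%:R <= p * #|I|%:R) || (p == 1 / 2) ->
  expR (- (#|I|%:R * nat_entropy p)) <= biased_mass p y.
Proof.
move=> /andP[p0 p2] Hy; have q0 : 0 < 1 - p by lra.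
have yI : (#|y| <= #|I|)%N by exact: max_card.
have -> : biased_mass p y = expR (ln p) ^+ #|y| * expR (ln (1 - p)) ^+ (#|I| - #|y|).
  by rewrite biased_massE !lnK ?posrE.
rewrite -[expR _ ^+ #|y|]expRM_natl -[expR _ ^+ (_ - _)]expRM_natl.
rewrite -expRD ler_expR natrB //.
set n : R := #|I|%:R in Hy *; set k : R := #|y|%:R in Hy *.
have lnpq : ln p <= ln (1 - p) by rewrite ler_ln ?posrE //; lra.
rewrite -subr_ge0 (_ : _ - _ = (p * n - k) * (ln (1 - p) - ln p)); last first.
  by rewrite /nat_entropy; ring.
case/orP: Hy => [kp|/eqP pE]; first by rewrite mulr_ge0 // subr_ge0.
by rewrite pE (_ : 1 - 1 / 2 = 1 / 2) ?subrr ?mulr0 //; lra.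
Qed.

(** Each coset meeting [S] has a leader that is no heavier than its element in [S]. Such leaders
    have mass at least [expR (- (#|I|%:R * nat_entropy p))] each, so their total mass bounds their
    number. *)
Lemma card_syndromes_le (I : finType) (C Hs : {set {set I}}) (w : nat) (p : R)
    (S : {set {set I}}) :
  0 < p <= 1 / 2 -> (0 < w)%N -> (0 < #|I|)%N ->
  {in Hs, forall h, dual_word C h} -> cover Hs = setT ->
  {in Hs, forall h : {set I}, (#|h| <= w)%N} ->
  {in S, forall y : {set I}, (#|y|%:R <= p * #|I|%:R) || (p == 1 / 2)} ->
  #|syndrome C @: S|%:R <= expR (#|I|%:R * (nat_entropy p - leader_exponent w p)).
Proof.
move=> p02 w0 I0 HsC covHs Hw HS; have /andP[p0 p2] := p02.
set L := [set y | leader C y & (#|y|%:R <= p * #|I|%:R) || (p == 1 / 2)].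
have sub : syndrome C @: S \subset syndrome C @: L.
  apply/subsetP=> _ /imsetP[y yS ->]; have [z [lz <- zy]] := leader_exists C y.
  apply: imset_f; rewrite inE lz /=; case/orP: (HS _ yS) => [yp|->]; last by rewrite orbT.
  by rewrite (le_trans _ yp) // ler_nat.
have : (#|syndrome C @: S| <= #|L|)%N.
  exact: leq_trans (subset_leq_card sub) (leq_imset_card _ _).
rewrite -(ler_nat R) => /le_trans; apply.
rewrite mulrBr expRD -ler_pdivrMl ?expR_gt0 // -expRN.
apply: le_trans (leader_mass p02 w0 I0 HsC covHs Hw).
rewrite -sum1_card natr_sum mulr_sumr big_mkcond [leRHS]big_mkcond /=.
apply: ler_sum => y _; rewrite inE mulr1.
case: (leader C y) => //=; case: ifP => [/(biased_mass_ge p02)//|_].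
by apply: biased_mass_ge0; lra.
Qed.

Lemma card_code_le (I : finType) (C Hs : {set {set I}}) (w : nat) (p lam lam2 : R)
    (f : {set I} -> R) :
  0 < p <= 1 / 2 -> (0 < w)%N -> (0 < #|I|)%N ->
  binary_linear C ->
  {in Hs, forall h, dual_word C h} -> cover Hs = setT ->
  {in Hs, forall h : {set I}, (#|h| <= w)%N} ->
  (forall y, 0 <= f y) -> 0 < f set0 ->
  (forall y, lam * f y <= \sum_i f (symdiff y [set i])) ->
  (forall y : {set I}, f y != 0 -> (#|y|%:R <= p * #|I|%:R) || (p == 1 / 2)) ->
  {in C, forall c : {set I}, c != set0 -> #|I|%:R - 2 * #|c|%:R <= lam2} ->
  lam2 <= #|I|%:R ->
  (lam - lam2) * #|C|%:R <=
    (#|I|%:R - lam2) * expR (#|I|%:R * (nat_entropy p - leader_exponent w p)).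
Proof.
move=> p02 w0 I0 linC HsC covHs Hw f_ge0 f0 f_sub f_supp gap lam2I.
apply: le_trans (card_code_le_syndromes linC f_ge0 f0 f_sub gap lam2I) _.
apply: ler_wpM2l; first by rewrite subr_ge0.
by apply: (card_syndromes_le p02 w0 I0 HsC covHs Hw) => y; rewrite inE => /f_supp.
Qed.

End LeaderMass.

(** * Repair groups and shortening *)

Section Shortening.
Variable I : finType.
Implicit Types (C : {set {set I}}) (c h S U : {set I}) (i j : I).

Definition shorten C U := [set c in C | [disjoint c & U]].

Lemma shortenU C S U : shorten (shorten C S) U = shorten C (S :|: U).
Proof. by apply/setP=> c; rewrite !inE -!setI_eq0 setIUr setU_eq0 andbA. Qed.

Lemma shorten_linear C U : binary_linear C -> binary_linear (shorten C U).
Proof.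
move=> [C0 CD]; split; first by rewrite inE C0 -setI_eq0 set0I eqxx.
move=> x y; rewrite !inE => /andP[xC xU] /andP[yC yU]; rewrite CD //=.
apply/pred0P => i /=; rewrite inE; case: (boolP (i \in U)) => iU; last by rewrite andbF.
by rewrite !(disjointFl _ iU).
Qed.

(** Translation by one codeword through [j] injects the codewords through [j] into those avoiding
    [j]. *)
Lemma card_shorten1 C j : binary_linear C -> (#|C| <= 2 * #|shorten C [set j]|)%N.
Proof.
move=> [C0 CD].
have D : shorten C [set j] = [set c in C | j \notin c].
  by apply/setP=> c; rewrite !inE disjoint_sym disjoints1.
rewrite D; have -> : #|C| = (#|[set c in C | j \in c]| + #|[set c in C | j \notin c]|)%N.
  by rewrite -(cardsID [set c : {set I} | j \in c] C); congr (_ + _)%N;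
    apply: eq_card => c; rewrite !inE // andbC.
rewrite mul2n -addnn leq_add2r.
have [->|/set0Pn[c1]] := eqVneq [set c in C | j \in c] set0; first by rewrite cards0.
rewrite inE => /andP[c1C jc1].
rewrite -(card_imset _ (inv_inj (symdiffK c1))); apply: subset_leq_card.
apply/subsetP => c' /imsetP[c]; rewrite inE => /andP[cC jc] ->.
by rewrite !inE CD // jc jc1.
Qed.

Lemma card_shorten C S : binary_linear C -> (#|C| <= 2 ^ #|S| * #|shorten C S|)%N.
Proof.
have [m] := ubnP #|S|; elim: m => // m IH in C S * => Sm linC.
have [->|[j jS]] := set_0Vmem S.
  rewrite cards0 expn0 mul1n subset_leq_card //; apply/subsetP=> c cC.
  by rewrite inE cC -setI_eq0 setI0 eqxx.
apply: leq_trans (card_shorten1 j linC) _.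
rewrite (cardsD1 j) jS add1n expnS -mulnA leq_pmul2l // -{2}(setD1K jS) -shortenU.
by apply: IH; [move: Sm; rewrite (cardsD1 j) jS|exact: shorten_linear].
Qed.

(** Induction on [S], shortening at some [j] in [S]. The word [h] obtained is orthogonal to all
    codewords avoiding [j]; if it is not orthogonal to all of [C], linearity makes its parity
    against [c] equal to the bit of [c] at [j], and adding [[set j]] repairs it. *)
Lemma dual_word_of_determined C S i : binary_linear C -> i \notin S ->
  {in C, forall c, [disjoint c & S] -> i \notin c} ->
  exists h, [/\ dual_word C h, i \in h & h \subset i |: S].
Proof.
have [m] := ubnP #|S|; elim: m => // m IH in C S * => Sm linC iS det.
have [S0|[j jS]] := set_0Vmem S.
  exists [set i]; split; rewrite ?inE ?subsetUl //.
  apply/forall_inP => c cC.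
  have ic : i \notin c by apply: det => //; rewrite S0 -setI_eq0 setI0.
  have -> : [set i] :&: c = set0 by apply/eqP; rewrite setI_eq0 disjoints1.
  by rewrite cards0.
have S'm : (#|S :\ j| < m)%N by move: Sm; rewrite (cardsD1 j) jS.
have ij : i != j by apply: contraNneq iS => ->.
have [|c|h [hC ih hS]] := IH (shorten C [set j]) (S :\ j) S'm (shorten_linear _ linC).
- by rewrite !inE (negbTE iS) andbF.
- rewrite inE => /andP[cC cj] cS; apply: det => //.
  by rewrite -(setD1K jS) -setI_eq0 setIUr setU_eq0 !setI_eq0 cj.
have inCj c : c \in C -> j \notin c -> ~~ odd #|h :&: c|.
  move=> cC jc; move/forall_inP: hC; apply.
  by rewrite inE cC disjoint_sym disjoints1.
have [hdual|] := boolP (dual_word C h).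
  exists h; split=> //; apply: subset_trans hS _; apply: setUS; exact: subsetDl.
rewrite negb_forall_in => /exists_inP[c1 c1C]; rewrite negbK => odd_c1.
have jc1 : j \in c1 by apply: contraLR odd_c1; exact: inCj.
have odd_c c : c \in C -> odd #|h :&: c| = (j \in c).
  move=> cC; case: (boolP (j \in c)) => jc; last by apply/negbTE/inCj.
  have := inCj _ (linC.2 _ _ cC c1C); rewrite inE jc jc1 => /(_ isT).
  by rewrite setIC odd_symdiffI !(setIC _ h) odd_c1 addbT negbK.
have hjC : dual_word C (symdiff h [set j]).
  apply/forall_inP => c cC; rewrite odd_symdiffI odd_c //.
  suff -> : odd #|[set j] :&: c| = (j \in c) by rewrite addbb.
  case: (boolP (j \in c)) => jc; first by rewrite (setIidPl _) ?sub1set // cards1.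
  have -> : [set j] :&: c = set0 by apply/eqP; rewrite setI_eq0 disjoints1.
  by rewrite cards0.
exists (symdiff h [set j]); split=> //.
  by rewrite !inE ih (negbTE ij).
apply/subsetP=> k; rewrite !inE; case: (eqVneq k j) => [->|_]; first by rewrite jS orbT.
by rewrite addbF => /(subsetP hS); rewrite !inE => /orP[->//|/andP[_ ->]]; rewrite orbT.
Qed.

(** Each round picks [i] outside [U] and a dual word [h] through [i]. Once a codeword vanishes on
    [U] and on the rest of [h], it vanishes at [i] for free, which saves a factor 2 per round. *)
Lemma repair_groups C (w t : nat) : binary_linear C -> (0 < w)%N -> (t * w <= #|I|)%N ->
  (forall i, exists h, [/\ dual_word C h, i \in h & (#|h| <= w)%N]) ->
  exists U, #|U| = (t * w)%N /\ (#|C| * 2 ^ t <= 2 ^ #|U| * #|shorten C U|)%N.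
Proof.
move=> linC w0 + rep; elim: t => [_|t IH twI].
  by exists set0; rewrite cards0 !muln1 mul1n; split=> //; move: (card_shorten set0 linC); rewrite cards0 mul1n.
have [|U [Ut CU]] := IH; first by lia.
have [i iU] : exists i, i \notin U.
  suff /set0Pn[i] : ~: U != set0 by rewrite inE; exists i.
  by rewrite -card_gt0 cardsCs setCK; lia.
have [h [/forall_inP hC ih hw]] := rep i.
pose S := (h :\: U) :\ i.
(* A codeword vanishing on [U :|: S] meets [h] in a subset of [[set i]]; by orthogonality this
   subset has even size and is empty. *)
have SU : shorten C (U :|: S) = shorten C (U :|: h).
  apply/setP=> c; rewrite !inE -!setI_eq0; case: (boolP (c \in C)) => //= cC.
  apply/eqP/eqP=> cS; apply/eqP; rewrite -subset0; apply/subsetP=> k.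
    have ch : h :&: c \subset [set i].
      apply/subsetP=> l; rewrite !inE => /andP[lh lc]; apply: contraT => li.
      by move/setP/(_ l): cS; rewrite !inE lc lh li andbT orbN.
    have hc0 : h :&: c = set0.
      move: ch; rewrite subset1 => /orP[/eqP hc1|/eqP//].
      by move: (hC _ cC); rewrite hc1 cards1.
    rewrite !inE => /andP[kc /orP[kU|kh]].
      by move/setP/(_ k): cS; rewrite !inE kc kU.
    by move/setP/(_ k): hc0; rewrite !inE kc kh.
  rewrite !inE => /andP[kc kUS]; move/setP/(_ k): cS; rewrite !inE kc /= => <-.
  by case/orP: kUS => [->//|/and3P[_ _ ->]]; rewrite orbT.
have Scard : (#|S|.+1 = #|h :\: U|)%N by rewrite [RHS](cardsD1 i) !inE iU ih.
have Uh : #|U :|: h| = (#|U| + #|h :\: U|)%N.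
  by have := cardsUI U h; have := cardsID U h; rewrite setIC; lia.
have := card_shorten S (shorten_linear U linC); rewrite shortenU SU => CS.
have hU : (#|h :\: U| <= w)%N by apply: leq_trans hw; rewrite subset_leq_card ?subsetDl.
(* Padding by arbitrary coordinates makes the size exactly [t.+1 * w], even if [h] is short or
   overlaps [U]. *)
have [V VUh Vcard] : exists2 V : {set I}, V \subset ~: (U :|: h) & #|V| = (t.+1 * w - #|U :|: h|)%N.
  exists [set x in take (t.+1 * w - #|U :|: h|) (enum (~: (U :|: h)))].
    by apply/subsetP=> x; rewrite inE => /mem_take; rewrite mem_enum.
  rewrite cardsE; apply/eqP; have /card_uniqP-> := take_uniq (t.+1 * w - #|U :|: h|) (enum_uniq (~: (U :|: h))).
  by rewrite size_takel // -cardE; have := cardsC (U :|: h); lia.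
have UhV : #|U :|: h :|: V| = (t.+1 * w)%N.
  have V0 : (U :|: h) :&: V = set0 by apply/eqP; rewrite setI_eq0 disjoint_sym disjoints_subset.
  by have := cardsUI (U :|: h) V; rewrite V0 cards0 addn0 => ->; lia.
exists (U :|: h :|: V); split=> //.
have := card_shorten V (shorten_linear (U :|: h) linC); rewrite shortenU => CV.
have -> : #|U :|: h :|: V| = (#|U| + #|S|.+1 + #|V|)%N by lia.
rewrite addnS addSn !expnS mulnCA -mulnA leq_pmul2l //; apply: leq_trans CU _.
rewrite -addnA expnD -mulnA leq_pmul2l ?expn_gt0 //; apply: leq_trans CS _.
by rewrite expnD -mulnA leq_pmul2l ?expn_gt0.
Qed.

End Shortening.

(** * Deleting the coordinates on which the shortened code vanishes *)

Section Puncture.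
Variables (I : finType) (U : {set I}).
Implicit Types c h : {set I}.
Notation J := {i : I | i \notin U}.

Definition restrict (c : {set I}) : {set J} := [set j | val j \in c].

Lemma imset_restrict c : [disjoint c & U] -> val @: restrict c = c.
Proof.
move=> dc; apply/setP=> i; apply/imsetP/idP=> [[j]|ic]; first by rewrite inE => jc ->.
have iU : i \notin U by rewrite (disjointFr dc ic).
by exists (exist _ i iU) => //; rewrite inE.
Qed.

Lemma card_restrict c : [disjoint c & U] -> #|restrict c| = #|c|.
Proof. by move=> dc; rewrite -[in RHS](imset_restrict dc) card_imset //; exact: val_inj. Qed.

Lemma card_punctured : #|{: J}| = (#|I| - #|U|)%N.
Proof. by rewrite card_sig -[RHS](_ : #|~: U| = _) ?[LHS]cardsCs ?setCK //; apply: eq_card => i; rewrite !inE. Qed.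

Lemma card_restrict_le c : (#|restrict c| <= #|c|)%N.
Proof.
rewrite -(card_imset _ val_inj); apply: subset_leq_card.
by apply/subsetP=> _ /imsetP[j + ->]; rewrite inE.
Qed.

Lemma restrict_linear (C : {set {set I}}) :
  binary_linear C -> binary_linear (restrict @: C).
Proof.
move=> [C0 CD]; split.
  by apply/imsetP; exists set0 => //; apply/setP=> j; rewrite !inE.
move=> _ _ /imsetP[x xC ->] /imsetP[y yC ->]; apply/imsetP; exists (symdiff x y); first exact: CD.
by apply/setP=> j; rewrite !inE.
Qed.

Lemma card_restrict_shorten (C : {set {set I}}) :
  #|restrict @: shorten C U| = #|shorten C U|.
Proof.
apply: card_in_imset => x y; rewrite !inE => /andP[_ dx] /andP[_ dy] xy.
by rewrite -(imset_restrict dx) xy imset_restrict.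
Qed.

Lemma restrict_dual (C : {set {set I}}) h :
  dual_word C h -> dual_word (restrict @: shorten C U) (restrict h).
Proof.
move=> /forall_inP hC; apply/forall_inP=> _ /imsetP[c + ->]; rewrite inE => /andP[cC dc].
have -> : restrict h :&: restrict c = restrict (h :&: c) by apply/setP=> j; rewrite !inE.
rewrite card_restrict ?hC //; exact: disjointWl (subsetIr h c) dc.
Qed.

End Puncture.

(** * Binary words as sets of coordinates *)

Section Support.
Variable n : nat.
Implicit Types (x y : 'rV['F_2]_n) (C : {set 'rV['F_2]_n}).

Definition support x : {set 'I_n} := [set i | x 0 i != 0].

Lemma F2_cases (a : 'F_2) : a = 0 \/ a = 1.
Proof.
by case: a => [[|[|a]] Ha] //; [left|right]; exact: val_inj.
Qed.

Lemma support0 : support 0 = set0.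
Proof. by apply/setP=> i; rewrite !inE mxE eqxx. Qed.

Lemma supportD x y : support (x + y) = symdiff (support x) (support y).
Proof.
apply/setP=> i; rewrite !inE mxE.
by case: (F2_cases (x 0 i)) => ->; case: (F2_cases (y 0 i)) => ->.
Qed.

Lemma support_inj : injective support.
Proof.
move=> x y /setP xy; apply/rowP=> i; have := xy i; rewrite !inE.
by case: (F2_cases (x 0 i)) => ->; case: (F2_cases (y 0 i)) => ->.
Qed.

Lemma support_linear C : is_linear_code C -> binary_linear (support @: C).
Proof.
move=> [C0 CD]; split; first by rewrite -support0 imset_f.
by move=> _ _ /imsetP[x xC ->] /imsetP[y yC ->]; rewrite -supportD imset_f // CD.
Qed.

Lemma support_dist (R : realType) C (d : R) c : is_linear_code C -> min_dist_ge C d ->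
  c \in support @: C -> c != set0 -> d <= #|c|%:R.
Proof.
move=> [C0 CD] dC /imsetP[x xC ->] x0.
have -> : support x = [set i | x 0 i != (0 : 'rV['F_2]_n) 0 i].
  by apply/setP=> i; rewrite !inE mxE.
apply: dC => //; apply: contraNneq x0 => ->; by rewrite support0.
Qed.

(* In a linear code, the zero word forces every recovery function to vanish at zero. *)
Lemma locality_dual (r : nat) C (i : 'I_n) : is_linear_code C -> has_locality r C ->
  exists h, [/\ dual_word (support @: C) h, i \in h & (#|h| <= r.+1)%N].
Proof.
move=> linC loc; have [S [iS Scard [phi phiE]]] := loc i.
have [||h [hC ih hS]] := @dual_word_of_determined _ (support @: C) (S :\ i) i (support_linear linC).
- by rewrite !inE eqxx.
- move=> _ /imsetP[x xC ->] dx; rewrite inE negbK (phiE _ xC).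
  have <- : (0 : 'rV['F_2]_n) 0 i = 0 by rewrite mxE.
  rewrite (phiE _ linC.1); apply/eqP; congr phi; apply/eq_in_map => j.
  rewrite mem_enum => jS; apply/eqP; rewrite mxE -[_ == 0]negbK.
  by have := disjointFl dx jS; rewrite inE => ->.
exists h; split=> //; rewrite -Scard -[S](setD1K iS); exact: subset_leq_card.
Qed.

(** Shortened words vanish on the deleted coordinates, so puncturing keeps their weights; restricted
    dual words stay dual, short and covering. Of the [t * r.+1] deleted coordinates, [t] are
    free. *)
Lemma code_reduction (R : realType) (r t : nat) C (d : R) :
  is_linear_code C -> has_locality r C -> min_dist_ge C d -> (t * r.+1 <= n)%N ->
  exists (J : finType) (C' Hs : {set {set J}}),
    [/\ #|J| = (n - t * r.+1)%N, binary_linear C',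
        [/\ {in Hs, forall h, dual_word C' h}, cover Hs = setT &
            {in Hs, forall h : {set J}, (#|h| <= r.+1)%N}],
        {in C', forall c : {set J}, c != set0 -> d <= #|c|%:R} &
        (#|C| <= 2 ^ (t * r) * #|C'|)%N].
Proof.
move=> linC loc dC tn; pose D := support @: C.
have linD : binary_linear D := support_linear linC.
have [|U [Ut DU]] := @repair_groups _ D r.+1 t linD (ltn0Sn r) _ (fun i => locality_dual i linC loc).
  by rewrite card_ord.
exists {i : 'I_n | i \notin U}, (restrict U @: shorten D U).
exists [set restrict U h | h in [set h | dual_word D h & (#|h| <= r.+1)%N]].
split.
- by rewrite card_punctured card_ord Ut.
- exact/restrict_linear/shorten_linear.
- split.
  + by move=> _ /imsetP[h + ->]; rewrite inE => /andP[hD _]; exact: restrict_dual.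
  + apply/eqP; rewrite -subTset; apply/subsetP=> j _.
    have [h [hD jh hr]] := locality_dual (val j) linC loc.
    apply/bigcupP; exists (restrict U h); last by rewrite inE.
    by apply: imset_f; rewrite inE hD.
  + by move=> _ /imsetP[h + ->]; rewrite inE => /andP[_]; apply: leq_trans; exact: card_restrict_le.
- move=> _ /imsetP[c + ->]; rewrite inE => /andP[cD dc] c0.
  rewrite card_restrict //; apply: (support_dist linC dC) => //.
  apply: contraNneq c0 => ->; by apply/eqP/setP=> j; rewrite !inE.
- rewrite card_restrict_shorten -(card_imset C support_inj) -/D.
  by move: DU; rewrite Ut mulnS expnD mulnC -mulnA leq_pmul2l ?expn_gt0.
Qed.

End Support.

(** * Entropy estimates *)

Section Estimates.
Variable R : realType.
Implicit Types (delta p d eta K : R) (w m : nat).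

Lemma tau_of_bounds delta : 0 <= tau_of delta <= 1 / 2.
Proof.
rewrite /tau_of; have s0 := sqrtr_ge0 (delta * (1 - delta)).
have : Num.sqrt (delta * (1 - delta)) <= 1 / 2.
  rewrite -[1 / 2]ger0_norm // -sqrtr_sqr ler_sqrt ?sqr_ge0 //.
  by have := sqr_ge0 (delta - 1 / 2); rewrite !expr2; lra.
by lra.
Qed.

(** This equation explains [tau_of]: a ball of radius about [n * tau] has top eigenvalue about 2 n
    sqrt(tau (1 - tau)), which must match the bound [n - 2 * d] with [d = delta * n]. *)
Lemma tau_of_sqr delta : 0 <= delta <= 1 ->
  4 * tau_of delta * (1 - tau_of delta) = (1 - 2 * delta) ^+ 2.
Proof.
move=> /andP[d0 d1]; rewrite /tau_of; set s := Num.sqrt _.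
have sE : s ^+ 2 = delta * (1 - delta) by rewrite sqr_sqrtr // mulr_ge0 // subr_ge0.
transitivity (1 - 4 * s ^+ 2); first by field.
by rewrite sE; ring.
Qed.

Lemma radial_eventually delta p K : 0 <= delta <= 1 / 2 ->
  tau_of delta < p < 1 / 2 -> 0 <= K ->
  exists N, forall m, (N <= m)%N ->
    (1 - 2 * delta) * m%:R + K + 1 <= m%:R /\
    exists g : nat -> R, [/\ forall k, 0 <= g k, 0 < g 0%N,
      forall k, g k != 0 -> k%:R <= p * m%:R &
      forall k, ((1 - 2 * delta) * m%:R + K + 1) * g k <=
        k%:R * g k.-1 + (m - k)%:R * g k.+1].
Proof.
move=> /andP[d0 d2] /andP[tp p2] K0.
have /andP[t0 _] := tau_of_bounds delta.
have tE := @tau_of_sqr delta ltac:(lra).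
set t := tau_of delta in tp t0 tE; set b := 1 - 2 * delta in tE *.
have b0 : 0 <= b by rewrite /b; lra.
(* The window runs from [p0 * m] to [p * m]; as [p0] exceeds [tau_of delta], the eigenvalue at its
   lower end already exceeds [b * m] by a fixed fraction [2 * eps] of [m]. *)
pose p0 := (t + p) / 2; have [tp0 p0p] : t < p0 /\ p0 < p by rewrite /p0; lra.
clearbody t b p0.
have p0E : b ^+ 2 < 4 * p0 * (1 - p0).
  rewrite -tE -subr_gt0 (_ : _ - _ = 4 * ((p0 - t) * (1 - t - p0))); last by ring.
  by rewrite mulr_gt0 // mulr_gt0 //; lra.
pose th := Num.sqrt (4 * p0 * (1 - p0)).
have thE : th ^+ 2 = 4 * p0 * (1 - p0).
  by rewrite sqr_sqrtr //; apply/ltW/(le_lt_trans _ p0E)/sqr_ge0.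
have th0 : 0 <= th by exact: sqrtr_ge0.
have bth : b < th by rewrite -ltr_sqr ?nnegrE // thE.
have th1 : th <= 1.
  rewrite -ler_sqr ?nnegrE // thE expr1n.
  by have := sqr_ge0 (1 - 2 * p0); rewrite expr2; lra.
clearbody th; pose eps := (th - b) / 2; have eps0 : 0 < eps by rewrite /eps; lra.
have thb : th = b + 2 * eps by rewrite /eps; field.
clearbody eps.
have X1 : 0 <= (K + 1) / eps by rewrite divr_ge0 ?ltW //; lra.
have X2 : 0 <= (2 + 2 * eps) / (eps * (p - p0)).
  by rewrite divr_ge0 ?mulr_ge0 ?ltW //; lra.
(* The first summand lets [eps * m] absorb [K + 1]; the second leaves a window of length at least
   [2 / eps] after both ends are rounded. *)
exists (Num.bound ((K + 1) / eps + (2 + 2 * eps) / (eps * (p - p0)))).+1 => m Nm.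
have m0 : 0 < m%:R :> R by rewrite ltr0n (leq_trans _ Nm).
have Xm : (K + 1) / eps + (2 + 2 * eps) / (eps * (p - p0)) <= m%:R.
  by apply/ltW/(lt_le_trans (archi_boundP (addr_ge0 X1 X2))); rewrite ler_nat ltnW.
have m1 : (K + 1) / eps <= m%:R by rewrite (le_trans _ Xm) // lerDl.
have m2 : (2 + 2 * eps) / (eps * (p - p0)) <= m%:R by rewrite (le_trans _ Xm) // lerDr.
rewrite ler_pdivrMr // in m1; rewrite ler_pdivrMr ?mulr_gt0 ?subr_gt0 // in m2.
clear X1 X2 Xm Nm; set M : R := m%:R in m0 m1 m2 *.
pose lam := b * M + K + 1; rewrite -/lam.
have lam_th : lam + eps * M <= th * M by rewrite thb /lam; lra.
have lam_gt0 : 0 < lam by rewrite /lam; have := mulr_ge0 b0 (ltW m0); lra.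
split; first by have := ler_wpM2r (ltW m0) th1; have := mulr_gt0 eps0 m0; lra.
have pM0 : 0 <= p * M by rewrite mulr_ge0 ?ltW //; lra.
have p0M0 : 0 <= p0 * M by rewrite mulr_ge0 ?ltW //; lra.
pose rho := Num.truncn (p * M); pose k0 := (Num.truncn (p0 * M)).+1.
have /andP[rho1 rho2] := truncn_itv pM0; rewrite -/rho -natr1 in rho1 rho2.
have /andP[k01 k02] := truncn_itv p0M0; rewrite -/k0 in k02.
have k03 : k0%:R <= p0 * M + 1 by rewrite /k0 -natr1; lra.
clear k01.
have window : 2 <= eps * (rho%:R - k0%:R).
  apply: (@le_trans _ _ (eps * ((p - p0) * M - 2))); first by lra.
  by apply: ler_wpM2l; [exact: ltW|lra].
have k0rho : (k0 <= rho)%N.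
  rewrite -(ler_nat R) -subr_ge0 -(pmulr_rge0 _ eps0); lra.
have p2M : p * M < M / 2 by have := mulr_gt0 (_ : 0 < 1 / 2 - p) m0; rewrite subr_gt0 => /(_ p2); lra.
have rhom : (rho.*2 < m)%N by rewrite -(ltr_nat R) -muln2 natrM; lra.
have disc k : (k0 <= k <= rho)%N ->
    (lam + eps * m%:R) ^+ 2 <= 4 * k%:R * (m%:R - k%:R).
  move=> /andP[k0k krho].
  have : k0%:R <= k%:R :> R by rewrite ler_nat.
  have : k%:R <= rho%:R :> R by rewrite ler_nat.
  move: k%:R => x x1 x2; rewrite -/M.
  apply: (@le_trans _ _ ((th * M) ^+ 2)).
    by apply: lerXn2r; rewrite ?nnegrE //; have := mulr_gt0 eps0 m0; lra.
  rewrite exprMn thE -subr_ge0.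
  rewrite (_ : _ - _ = 4 * ((x - p0 * M) * (M - x - p0 * M))); last by ring.
  by rewrite mulr_ge0 // mulr_ge0 //; lra.
have k0m : (k0.*2 <= m)%N by rewrite (leq_trans _ (ltnW rhom)) // leq_double.
have rm : (rho < m)%N by rewrite (leq_ltn_trans _ rhom) // -addnn leq_addr.
have [|g [g0 g00 gz gs]] := radial_supersolution lam_gt0 eps0 (ltn0Sn _) k0rho k0m rm disc.
  by rewrite natrB.
exists g; split=> // k gk; apply: le_trans rho1; rewrite ler_nat leqNgt.
by apply: contra gk => /gz->.
Qed.

(** The first entropy term grows by at most [- (d * ln d)], bounded by [2 * Num.sqrt d] through ln x
    < x at the inverse of the square root; the second grows by at most [d]. *)
Lemma entropy_shift p d : 0 <= p -> 0 < d -> p + d <= 1 / 2 ->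
  nat_entropy (p + d) <= nat_entropy p + d + 2 * Num.sqrt d.
Proof.
move=> p0 d0 pd; rewrite /nat_entropy.
pose e := Num.sqrt d; have e0 : 0 < e by rewrite sqrtr_gt0.
have dE : d = e ^+ 2 by rewrite sqr_sqrtr // ltW.
have dlnd : - (d * ln d) <= 2 * e.
  have -> : ln d = 2 * ln e by rewrite dE lnXn // mulr_natl.
  have := ltW (ln_sublinear (_ : 0 < e^-1)); rewrite invr_gt0 => /(_ e0).
  rewrite lnV ?posrE // => H.
  have He : e * (- ln e) <= 1 by rewrite -ler_pdivlMl // mulr1.
  rewrite dE (_ : - _ = 2 * e * (e * (- ln e))); last by ring.
  by rewrite ler_piMr // mulr_ge0 // ltW.
have plnp : p * ln p <= p * ln (p + d).
  have [<-|pn0] := eqVneq 0 p; first by rewrite !mul0r.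
  have pp : 0 < p by rewrite lt_neqAle pn0.
  by rewrite ler_pM2l // ler_ln ?posrE; lra.
have dlnp : d * ln d <= d * ln (p + d) by rewrite ler_pM2l // ler_ln ?posrE; lra.
have a0 : 0 < 1 - (p + d) by lra.
have lnb : ln (1 - p) <= 0 by rewrite ln_le0 //; lra.
have lnq : ln (1 - p) - ln (1 - (p + d)) <= d / (1 - (p + d)).
  rewrite -ln_div ?posrE //; last by lra.
  have -> : (1 - p) / (1 - (p + d)) = 1 + d / (1 - (p + d)) by field; rewrite gt_eqF.
  apply: le_ln1Dx; apply: (@lt_le_trans _ _ 0) => //; exact/ltW/divr_gt0.
rewrite ler_pdivlMr // in lnq; have := mulr_ge0_le0 (ltW d0) lnb.
by rewrite -/e; lra.
Qed.

Lemma leader_exponent_homo w p q : 0 <= p -> p <= q ->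
  leader_exponent w p <= leader_exponent w q.
Proof.
move=> p0 pq; have q0 := le_trans p0 pq.
rewrite ler_wpM2r ?invr_ge0 ?mulr_ge0 //.
apply: lerXn2r; rewrite ?nnegrE ?divr_ge0 ?exprn_ge0 //.
by rewrite ler_wpM2r ?invr_ge0 //; apply: lerXn2r; rewrite ?nnegrE.
Qed.

Lemma ln2_ge : 1 / 2 <= ln 2 :> R.
Proof.
have := @le_ln1Dx R (- (1 / 2)); rewrite (_ : 1 + - (1 / 2) = 2^-1); last by field.
by rewrite lnV ?posrE // => H; have := H ltac:(lra); lra.
Qed.

(** The exponent is at most [p / 8] and the entropy at least [p / 2], because [ln p] is at most
    [- (1 / 2)]. *)
Lemma leader_exponent_le_entropy w p : (0 < w)%N -> 0 <= p <= 1 / 2 ->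
  leader_exponent w p <= nat_entropy p.
Proof.
case: w => // w _ /andP[p0 p2].
have Hp : leader_exponent w.+1 p <= p / 8.
  have x0 : 0 <= p ^+ w.+1 / 2 by rewrite divr_ge0 ?exprn_ge0.
  have xp : p ^+ w.+1 / 2 <= p.
    rewrite exprS -mulrA ler_piMr // ler_pdivrMr // mul1r.
    by apply: (@le_trans _ _ 1); [apply: exprn_ile1 => //; lra|rewrite ler1n].
  rewrite /leader_exponent; apply: ler_pM; first exact: exprn_ge0.
  - by rewrite invr_ge0 mulr_ge0.
  - apply: le_trans (xp); rewrite exprS ler_piMr // exprn_ile1 //.
    by apply: (le_trans xp); lra.
  - by rewrite lef_pV2 ?posrE ?mulr_gt0 // ?ltr0n ?ler_peMr ?ler1n // expn_gt0.
apply: (le_trans Hp); rewrite /nat_entropy.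
have lnq : (1 - p) * ln (1 - p) <= 0 by rewrite mulr_ge0_le0 ?ln_le0 //; lra.
have [<-|pn0] := eqVneq 0 p; first by rewrite !mul0r subr0 ln1 mulr0; lra.
have pp : 0 < p by rewrite lt_neqAle pn0.
have : ln p <= - (1 / 2).
  apply: (@le_trans _ _ (ln 2^-1)); first by rewrite ler_ln ?posrE //; lra.
  by rewrite lnV ?posrE // lerN2 ln2_ge.
by rewrite -(ler_pM2l pp); lra.
Qed.

Lemma h2_nat_entropy p : h2 p = nat_entropy p / ln 2.
Proof. by rewrite /h2 /nat_entropy /log2; ring. Qed.

Lemma c_const_leader_exponent w p : c_const w p = leader_exponent w p / ln 2.
Proof.
rewrite /c_const /leader_exponent /log2 expRK.
by rewrite mul1r [LHS]mulrC mulrA mulrAC.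
Qed.

Lemma ln_sublinear_eventually (A kappa : R) : 0 < kappa ->
  exists N, forall n, (N <= n)%N -> ln n%:R + A <= kappa * n%:R.
Proof.
move=> k0; have k2 : 0 < kappa / 2 by lra.
pose B := `|A - ln (kappa / 2)| / (kappa / 2).
have B0 : 0 <= B by rewrite divr_ge0 // ltW.
exists (Num.bound B).+1 => n Nn.
have n0 : 0 < n%:R :> R by rewrite ltr0n; lia.
have Bn : B <= n%:R.
  by apply/ltW/(lt_le_trans (archi_boundP B0)); rewrite ler_nat; lia.
rewrite /B ler_pdivrMr // in Bn.
have := ltW (ln_sublinear (mulr_gt0 k2 n0)); rewrite lnM ?posrE //.
by have := ler_norm (A - ln (kappa / 2)); lra.
Qed.

End Estimates.

(** * Asymptotic bound *)

Section CodeBound.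
Variable R : realType.

Definition nat_rate (w : nat) (delta : R) : R :=
  nat_entropy (tau_of delta) - leader_exponent w (tau_of delta).

Lemma small_shift (tau eta : R) : tau < 1 / 2 -> 0 < eta ->
  exists d, [/\ 0 < d, tau + d < 1 / 2 & d + 2 * Num.sqrt d <= eta].
Proof.
move=> t2 eta0; pose e := Num.min 1 (eta / 3).
have e0 : 0 < e by rewrite lt_min; lra.
have [e1 e3] : e <= 1 /\ e <= eta / 3 by rewrite !ge_min !lexx orbT.
pose d := Num.min (e ^+ 2) ((1 / 2 - tau) / 2); exists d.
have d0 : 0 < d by rewrite lt_min exprn_gt0 //=; lra.
have [de dt] : d <= e ^+ 2 /\ d <= (1 / 2 - tau) / 2 by rewrite !ge_min !lexx orbT.
split=> //; first lra.
have sd : Num.sqrt d <= e.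
  by rewrite -ler_sqr ?nnegrE ?sqrtr_ge0 ?(ltW e0) // sqr_sqrtr // (ltW d0).
have : e ^+ 2 <= e by rewrite expr2 ler_piMr // ltW.
lra.
Qed.

(** The loss of [w] in the distance hypothesis leaves room for rounding the number of repair groups
    to an integer. *)
Lemma card_code_eventually (w : nat) (delta eta : R) :
  0 <= delta <= 1 / 2 -> (0 < w)%N -> 0 < eta ->
  exists N, forall (I : finType) (C Hs : {set {set I}}), (N <= #|I|)%N ->
    binary_linear C ->
    {in Hs, forall h, dual_word C h} -> cover Hs = setT ->
    {in Hs, forall h : {set I}, (#|h| <= w)%N} ->
    {in C, forall c : {set I}, c != set0 -> delta * (#|I|%:R - w%:R) <= #|c|%:R} ->
    #|C|%:R <= #|I|%:R * expR (#|I|%:R * (nat_rate w delta + eta)).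
Proof.
move=> d02 w0 eta0; rewrite /nat_rate.
have /andP[t0] := tau_of_bounds delta; rewrite le_eqVlt => /orP[/eqP tE|t2].
  (* Here the ball is the whole cube: the constant function has eigenvalue [#|I|], and nonzero words
     have weight at least 1, which gives a gap of 2. *)
  exists 1%N => I C Hs I0 linC HsC covHs Hw _; rewrite tE.
  have n1 : 1 <= #|I|%:R :> R by rewrite ler1n.
  have half : (0 < 1 / 2 :> R) && (1 / 2 <= 1 / 2 :> R) by apply/andP; split; lra.
  have := @card_code_le R I C Hs w (1 / 2) #|I|%:R (#|I|%:R - 2) (fun=> 1)
    half w0 I0 linC HsC covHs Hw (fun=> ler01) ltr01.
  have -> : #|I|%:R - (#|I|%:R - 2) = 2 :> R by rewrite opprB addrC subrK.
  set E := nat_entropy _ - _ => H.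
  have {}H : #|C|%:R <= expR (#|I|%:R * E).
    rewrite -(ler_pM2l (ltr0n R 2)); apply: H.
    - by move=> y; rewrite mulr1 sumr_const.
    - by move=> y _; rewrite eqxx orbT.
    - move=> c cC c0; rewrite lerD2l lerN2 ler_peMr // ler1n card_gt0 //.
    - by rewrite lerBlDr lerDl.
  apply: (le_trans H); apply: (@le_trans _ _ (expR (#|I|%:R * (E + eta)))).
    by rewrite ler_expR ler_wpM2l // lerDl ltW.
  by rewrite ler_peMl // expR_ge0.
have [d [d0 td ed]] := small_shift t2 eta0.
have w_ge0 : 0 <= w%:R :> R by [].
have tdp : tau_of delta < tau_of delta + d < 1 / 2 by rewrite ltrDl d0.
have [N HN] := radial_eventually d02 tdp w_ge0.
exists N.+1 => I C Hs NI linC HsC covHs Hw dist.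
have [lam_le [g [g0 g00 gz gs]]] := HN _ (ltnW NI).
have I0 : (0 < #|I|)%N by apply: leq_trans NI.
(* With [K = w] the gap [lam - lam2] is 1, and [lam2] bounds the nontrivial eigenvalues since
   [2 * delta * w] is at most [w]. *)
set lam := _ + _ + 1 in lam_le gs; set lam2 := (1 - 2 * delta) * #|I|%:R + w%:R.
have lamE : lam = lam2 + 1 by [].
have p02 : 0 < tau_of delta + d <= 1 / 2 by apply/andP; split; lra.
have := @card_code_le R I C Hs w _ lam lam2 (fun y => g #|y|) p02 w0 I0 linC HsC covHs Hw.
rewrite cards0 lamE [_ + 1 - _]addrC addKr [1 * #|C|%:R]mul1r => H.
have {}H : #|C|%:R <= (#|I|%:R - lam2) * expR (#|I|%:R *
    (nat_entropy (tau_of delta + d) - leader_exponent w (tau_of delta + d))).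
  apply: H => //.
  - by move=> y; rewrite sum_neighbours_radial -lamE; exact: gs.
  - by move=> y /gz ->.
  - move=> c cC c0; have := dist _ cC c0; rewrite /lam2.
    have /andP[dd0 dd2] := d02.
    have : delta * w%:R <= 1 / 2 * w%:R by rewrite ler_wpM2r.
    move: #|I|%:R w%:R #|c|%:R => u v z; lra.
  - by move: lam_le; rewrite lamE; lra.
apply: (le_trans H); apply: ler_pM => //.
- by rewrite subr_ge0; move: lam_le; rewrite lamE; lra.
- rewrite lerBlDr lerDl /lam2 addr_ge0 // mulr_ge0 //.
  by move/andP: d02 => [_]; lra.
rewrite ler_expR ler_wpM2l //.
have := entropy_shift t0 d0 (ltW td).
have := @leader_exponent_homo R w _ _ t0 (_ : tau_of delta <= tau_of delta + d).
by rewrite lerDl ltW // => /(_ isT); lra.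
Qed.

Lemma nat_rate_ge0 (w : nat) (delta : R) : (0 < w)%N -> 0 <= nat_rate w delta.
Proof.
by move=> w0; rewrite subr_ge0 leader_exponent_le_entropy // tau_of_bounds.
Qed.

Lemma R0_nat_rate (r : nat) (delta : R) : R0 r delta = nat_rate r.+1 delta / ln 2.
Proof. by rewrite /R0 h2_nat_entropy c_const_leader_exponent -mulrBl. Qed.

(** The rate vanishes at 1/2 and is nowhere negative. This covers the values of
    [delta / (1 - s * r.+1%:R)] above 1/2, where the code bound is applied at 1/2 instead. *)
Lemma nat_rate_min (w : nat) (delta : R) : (0 < w)%N ->
  nat_rate w (Num.min delta (1 / 2)) <= nat_rate w delta.
Proof.
move=> w0; case: (leP delta (1 / 2)) => // _; suff -> : nat_rate w (1 / 2) = 0 by exact: nat_rate_ge0.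
have -> : nat_rate w (1 / 2) = nat_entropy (0 : R) - leader_exponent w 0.
  rewrite /nat_rate; suff -> : tau_of (1 / 2 : R) = 0 by [].
  rewrite /tau_of (_ : 1 / 2 * (1 - 1 / 2) = (1 / 2) ^+ 2); last by field.
  by rewrite sqrtr_sqr ger0_norm ?subrr.
rewrite /nat_entropy /leader_exponent subr0 ln1 mulr0 mul0r expr0n.
by case: w w0 => // w _; rewrite mul0r expr0n mul0r !subr0 oppr0.
Qed.

Lemma M_lin_eventually (r : nat) (delta s eta : R) :
  0 <= delta <= 1 / 2 -> 0 <= s -> s < 1 / r.+1%:R -> 0 < eta ->
  exists N, forall n, (N <= n)%N ->
    n%:R^-1 * log2 (M_lin n r (delta * n%:R))%:R <=
    s * r%:R + (1 - s * r.+1%:R) * R0 r (delta / (1 - s * r.+1%:R)) + eta.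
Proof.
move=> /andP[d0 d2] s0 sr eta0.
set W : R := r.+1%:R; pose sg := 1 - s * W; rewrite -/sg.
have W0 : 0 < W by rewrite ltr0n.
have sg0 : 0 < sg by rewrite subr_gt0 -ltr_pdivlMr.
have sg1 : sg <= 1 by rewrite /sg lerBlDr lerDl mulr_ge0 // ltW.
have l2 := @ln2_ge R; have l0 : 0 < ln 2 :> R by lra.
pose d1 := Num.min (delta / sg) (1 / 2).
have d1_02 : 0 <= d1 <= 1 / 2.
  by rewrite ge_min lexx orbT le_min (divr_ge0 d0 (ltW sg0)) divr_ge0.
pose E := nat_rate r.+1 d1; have E0 : 0 <= E by exact: nat_rate_ge0.
have ER : E <= ln 2 * R0 r (delta / sg).
  by rewrite R0_nat_rate mulrC divfK ?gt_eqF //; exact: nat_rate_min.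
(* One share [n%:R * eta1] pays for the loss in the code bound, another for [ln n%:R] and the
   rounding term [W * (E + eta1)]. *)
pose eta1 := eta * ln 2 / 4; have eta10 : 0 < eta1 by rewrite divr_gt0 ?mulr_gt0.
have [N1 HN1] := card_code_eventually d1_02 (ltn0Sn r) eta10.
have [N2 HN2] := @ln_sublinear_eventually R (W * (E + eta1)) eta1 eta10.
exists (Num.bound (N1.+1%:R / sg) + N2 + 1)%N => n Nn.
have n0 : 0 < n%:R :> R by rewrite ltr0n (leq_trans _ Nn) // addn1.
have bound1 : N1.+1%:R <= sg * n%:R.
  rewrite mulrC -ler_pdivrMr //; apply/ltW/(lt_le_trans (archi_boundP _)).
    by rewrite divr_ge0 ?ltW.
  by rewrite ler_nat (leq_trans _ Nn) // -addnA leq_addr.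
have {HN2} bound2 := HN2 n (leq_trans (leq_trans (leq_addl _ _) (leq_addr _ _)) Nn).
have sn0 : 0 <= s * n%:R by rewrite mulr_ge0 // ltW.
pose t := Num.truncn (s * n%:R).
have /andP[t1 t2] := truncn_itv sn0; rewrite -/t -natr1 in t1 t2.
clearbody t; move: Nn => _.
have tW : t%:R * W <= s * n%:R * W by rewrite ler_wpM2r // ltW.
have tW' : s * n%:R * W <= t%:R * W + W by have := ler_wpM2r (ltW W0) (ltW t2); lra.
have sgn : sg * n%:R = n%:R - s * n%:R * W by rewrite /sg; ring.
have sgn0 : 0 < sg * n%:R by rewrite mulr_gt0.
have tn : (t * r.+1 <= n)%N by rewrite -(ler_nat R) natrM -/W; lra.
pose m := (n - t * r.+1)%N.
have mE : m%:R = n%:R - t%:R * W by rewrite /m natrB // natrM.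
have m_lo : sg * n%:R <= m%:R by rewrite mE; lra.
have m_hi : m%:R <= sg * n%:R + W by rewrite mE; lra.
have m_n : m%:R <= n%:R :> R by rewrite ler_nat leq_subr.
have mN1 : (N1 <= m)%N by rewrite ltnW // -(ler_nat R); lra.
have m0 : 0 < m%:R :> R by lra.
pose X : R := t%:R * r%:R * ln 2 + ln m%:R + m%:R * (E + eta1).
have code_le (C : {set 'rV['F_2]_n}) : is_linear_code C -> has_locality r C ->
    min_dist_ge C (delta * n%:R) -> #|C|%:R <= expR X.
  move=> linC loc dC.
  have [J [C' [Hs [Jm linC' [HsC' covHs Hw] dist Ccard]]]] := code_reduction linC loc dC tn.
  have {}dist : {in C', forall c : {set J}, c != set0 -> d1 * (#|J|%:R - r.+1%:R) <= #|c|%:R}.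
    move=> c cC' c0; apply: le_trans (dist c cC' c0); rewrite Jm -/m -/W.
    apply: (@le_trans _ _ (d1 * (sg * n%:R))).
      by apply: ler_wpM2l; [by case/andP: d1_02|lra].
    apply: (@le_trans _ _ (delta / sg * (sg * n%:R))).
      by apply: ler_wpM2r; [exact: ltW|rewrite ge_min lexx].
    by rewrite mulrA divfK ?gt_eqF.
  have := HN1 J C' Hs; rewrite Jm -/m => /(_ mN1 linC' HsC' covHs Hw).
  rewrite Jm in dist => /(_ dist) C'le.
  have : #|C|%:R <= 2 ^+ (t * r) * #|C'|%:R :> R by rewrite -natrX -natrM ler_nat.
  move=> /le_trans; apply.
  have -> : expR X = 2 ^+ (t * r) * (m%:R * expR (m%:R * (E + eta1))).
    rewrite /X !expRD lnK ?posrE // -natrM expRM_natl lnK ?posrE //.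
    by rewrite mulrA.
  by rewrite ler_wpM2l // exprn_ge0.
have M_le : (M_lin n r (delta * n%:R))%:R <= expR X.
  rewrite -truncn_ge_nat ?expR_ge0 //; apply/bigmax_leqP => C /asboolP[linC [loc dC]].
  by rewrite truncn_ge_nat ?expR_ge0 //; exact: code_le.
set T := s * r%:R + sg * _.
have T0 : 0 <= T.
  apply: addr_ge0; first by rewrite mulr_ge0.
  by apply: mulr_ge0 (ltW sg0) _; rewrite -(pmulr_rge0 _ l0) (le_trans E0).
rewrite mulrC ler_pdivrMr // /log2 ler_pdivrMr //.
(* If no code exists, the convention that [ln] is 0 at 0 leaves only the positivity of [T + eta]. *)
have [->|M0] := posnP (M_lin n r (delta * n%:R)).
  rewrite ln0 //; apply/ltW; rewrite !mulr_gt0 //; exact: ltr_wpDl.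
have lnM_le : ln (M_lin n r (delta * n%:R))%:R <= X.
  by rewrite -[X]expRK ler_ln ?posrE ?ltr0n ?expR_gt0.
apply: (le_trans lnM_le).
have x1 : t%:R * r%:R * ln 2 <= s * n%:R * r%:R * ln 2.
  by apply: ler_wpM2r; [exact: ltW|exact: ler_wpM2r].
have x2 : ln m%:R <= ln n%:R :> R by rewrite ler_ln ?posrE.
have x3 : m%:R * (E + eta1) <= (sg * n%:R + W) * (E + eta1).
  by rewrite ler_wpM2r // addr_ge0 // ltW.
have x4 : sg * n%:R * E <= sg * n%:R * (ln 2 * R0 r (delta / sg)).
  by rewrite ler_wpM2l // ltW.
have x5 : sg * n%:R * eta1 <= n%:R * eta1.
  by apply: ler_wpM2r; [exact: ltW|rewrite ler_piMl // ltW].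
have x6 : 4 * (n%:R * eta1) = n%:R * eta * ln 2 by rewrite /eta1; field.
have x7 : 0 <= n%:R * eta1 by rewrite mulr_ge0 // ltW.
rewrite /X (_ : (T + eta) * n%:R * ln 2 = s * n%:R * r%:R * ln 2 +
  sg * n%:R * (ln 2 * R0 r (delta / sg)) + n%:R * eta * ln 2); last first.
  by rewrite /T; ring.
rewrite -x6.
move: x1 x2 x3 x4 x5 x7 bound2.
move: (t%:R * r%:R * ln 2) (s * n%:R * r%:R * ln 2) (ln m%:R) (ln n%:R) (m%:R * (E + eta1))
  (sg * n%:R * (ln 2 * R0 r (delta / sg))) => y1 y2 y3 y4 y5 y6.
clear; lra.
Qed.

End CodeBound.

Theorem theorem6 (R : realType) (r : nat) (delta : R) :
  (1 <= r)%N -> 0 <= delta <= 1 / 2 ->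
  forall s : R, 0 <= s -> s < 1 / (r.+1)%:R ->
    (R_lin r delta <=
      (s * r%:R + (1 - s * (r.+1)%:R) * R0 r (delta / (1 - s * (r.+1)%:R)))%:E)%E.
Proof.
move=> _ d02 s s0 sr; apply/lee_addgt0Pr => eta eta0; rewrite -EFinD.
have [N HN] := M_lin_eventually d02 s0 sr eta0.
(* The upper limit is at most the supremum over the tail from [N] on. *)
apply: (@le_trans _ _ (ereal_sup [set ((n%:R)^-1 * log2 (M_lin n r (delta * n%:R))%:R)%:E
    | n in [set n | (N <= n)%N]])%classic).
  by apply: ereal_inf_lbound; exists [set n | (N <= n)%N]%classic => //; exact: nbhs_infty_ge.
by apply: ge_ereal_sup => _ [n /= Nn <-]; rewrite lee_fin; exact: HN.
Qed.
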